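(* 1. Let $k\ge2$, and let $(M,\Omega_1,\mu_1,p_1)$ and $(M,\Omega_2,\mu_2,p_2)$ be $k$-integrable statistical models, where $\Omega_1,\Omega_2$ are smooth manifolds (with Borel $\sigma$-algebras) and $\mu_1,\mu_2$ are Lebesgue probability measures. Let $(f,T_* )$ be a representable restricted Markov morphism from the first to the second: $f:M\to M$ is a diffeomorphism, $T_*$ is a $\mu_2$-representable Markov morphism (with positive kernel), and $p_2(f(x))=T_*(p_1(x))$ for all $x\in M$. Then $(f,T_* )$ decreases the Fisher metric: writing $g_i^F$ for the Fisher quadratic form of $(M,\Omega_i,\mu_i,p_i)$, for all $x\in M$ and $V\in T_xM$, $$g_2^F(df(V),df(V))_{f(x)}\le g_1^F(V,V)_x .$$ 2. The Fisher metric is, up to a constant, the unique local weakly continuous quadratic form field on statistical models associated with finite sample spaces $\{\Omega_n\}_{n\ge1}$ ($|\Omega_n|=n$) that is monotone under representable restricted Markov morphisms.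
   Context: For a finite non-negative measure $\mu$ on a measurable space $\Omega$, $\mathcal P_+(\Omega,\mu)=\{\phi\mu:\phi\in L^1(\Omega,\mu),\ \phi>0\ \mu\text{-a.e.},\ \int\phi\,d\mu=1\}$ with the $L^1$-topology. For $k\ge1$, a $k$-integrable statistical model $(M,\Omega,\mu,p)$ consists of a smooth (finite or infinite dimensional) Banach manifold $M$, a finite reference measure $\mu$ and a continuous map $p:M\to\mathcal P_+(\Omega,\mu)$ for which there is a density potential $\bar p:M\times\Omega\to\mathbb{R}$, $p(x)=\bar p(x,\cdot)\mu$, such that: (i) for $\mu$-almost all $\omega$, $x\mapsto\ln\bar p(x,\omega)$ is defined and continuously Gâteaux-differentiable, i.e. $V\mapsto\partial_V\ln\bar p(x,\omega)$ is continuous on $TM$ and linear on each $T_xM$; (ii) for every continuous vector field $V$ on $M$, $\partial_V\ln\bar p(x,\cdot)\in L^k(\Omega,p(x))$ and $x\mapsto\|\partial_V\ln\bar p(x,\cdot)\|_{L^k(\Omega,p(x))}$ is continuous. The Fisher quadratic form (metric) is $g^F(V,W)_x=\int_\Omega\partial_V\ln\bar p\,\partial_W\ln\bar p\,dp(x)$. A Lebesgue measure on a smooth manifold is a measure locally equivalent to Lebesgue measure on $\mathbb{R}^n$. For a probability measure $\mu_2$ on $\Omega_2$, a positive Markov kernel is a (jointly) measurable $\Pi:\Omega_1\times\Omega_2\to\mathbb{R}$ with $\Pi>0$ and $\int_{\Omega_2}\Pi(\omega_1,\omega_2)\,d\mu_2(\omega_2)=1$ for all $\omega_1$. A Markov morphism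 $T_*$ is $\mu_2$-representable (by a positive kernel) if $T_*(\nu)(S)=\int_{\Omega_1}\int_S\Pi(\omega_1,\omega_2)\,d\mu_2(\omega_2)\,d\nu(\omega_1)$ for such a $\Pi$. (The paper restricts to positive kernels throughout the relevant section.) A restricted Markov morphism from $(M,\Omega_1,\mu_1,p_1)$ to $(M,\Omega_2,\mu_2,p_2)$ is a pair $(f,T_* )$ with $f$ a $C^1$ map and $p_2(f(x))=T_*(p_1(x))$ for all $x\in M$; it is representable if $f$ is a diffeomorphism and $T_*$ is $\mu_2$-representable. In part 2, a quadratic form field $F$ assigns to each statistical model $(M,\Omega_n,\mu_n,p)$, with $\mu_n$ the uniform probability measure on the $n$-element set $\Omega_n$, a symmetric bilinear form on each $T_xM$. It is local if its value at $x$ depends only on $p(x)$ and on the functions $\partial_V\ln\bar p(x,\cdot)$: $F(V,W)_x=\tilde F_{p(x)}(\partial_V\ln\bar p(x),\partial_W\ln\bar p(x))$ for a bilinear form $\tilde F_\mu$ on $L^2(\Omega_n,\mu)$, $\mu\in\mathcal P_+(\Omega_n,\mu_n)$. It is weakly continuous if $F(V,W)$ is a continuous function on $M$ for all continuous vector fields $V,W$. It is monotone if $F_2(df(V),df(V))_{f(x)}\le F_1(V,V)_x$ for all representable restricted Markov morphisms $(f,T_* )$ between such models, where $F_i$ is the form assigned to the $i$-th model. Uniqueness up to a constant means that every such field equals $c\,g^F$ for some constant $c$. *)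

(* Defs.v *)
From HB Require Import structures.
From mathcomp Require Import all_boot all_order all_algebra.
From mathcomp Require Import all_classical all_reals all_analysis.

Set Implicit Arguments.
Unset Strict Implicit.
Unset Printing Implicit Defensive.

Import Order.TTheory GRing.Theory Num.Theory.
Import numFieldNormedType.Exports.

Local Open Scope classical_set_scope.
Local Open Scope ring_scope.

HB.instance Definition _ (R : realType) (n : nat) := Complete.on 'rV[R]_n.

Section differentiability.
Context {R : realType} {E F : normedModType R}.

(* [D x] restricted to lists of length [m <= n] is the m-th Fréchet derivative
   of [f] at [x], seen as a bounded m-linear map; the limits are taken in the
   operator norm of m-linear maps. *)
Definition Cn_on (n : nat) (U : set E) (f : E -> F) : Prop :=
  exists D : E -> seq E -> F,
  [/\ (forall x, U x -> D x [::] = f x),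
      (forall x, U x -> forall s t : seq E, (size s + size t < n)%N ->
         linear (fun h => D x (s ++ h :: t))),
      (forall x, U x -> forall m, (m <= n)%N -> exists C : R,
         forall v : m.-tuple E, `|D x v| <= C * \prod_(e <- v) `|e|),
      (forall x, U x -> forall m, (m < n)%N -> forall eps : R, 0 < eps ->
         \forall y \near x, forall v : m.-tuple E,
           `|D y v - D x v - D x ((y - x) :: v)|
             <= eps * `|y - x| * \prod_(e <- v) `|e|)
    & (forall x, U x -> forall eps : R, 0 < eps ->
         \forall y \near x, forall v : n.-tuple E,
           `|D y v - D x v| <= eps * \prod_(e <- v) `|e|)].

Definition smooth_on (U : set E) (f : E -> F) : Prop := forall n, Cn_on n U f.

End differentiability.

(* Charts and their inverses are total functions; only their values on
   [chart_dom i], resp. on the image of [chart_dom i], are meaningful.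
   [chart_at] selects a chart around each point. *)
Record atlas (R : realType) (M : topologicalType) (I : Type)
    (E : I -> completeNormedModType R) := Atlas {
  chart_dom : I -> set M ;
  chart : forall i, M -> E i ;
  chart_inv : forall i, E i -> M ;
  chart_at : M -> I ;
  chart_atP : forall x, chart_dom (chart_at x) x ;
  chart_dom_open : forall i, open (chart_dom i) ;
  chart_im_open : forall i, open (chart i @` chart_dom i) ;
  chartK : forall i x, chart_dom i x -> chart_inv (chart i x) = x ;
  chart_continuous : forall i x, chart_dom i x ->
    {for x, continuous (chart i)} ;
  chart_inv_continuous : forall i y, (chart i @` chart_dom i) y ->
    {for y, continuous (@chart_inv i)} ;
  chart_transition : forall i j,
    smooth_on (chart i @` (chart_dom i `&` chart_dom j))
              (chart j \o @chart_inv i) }.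

Arguments chart_inv {R M I E} a i _.
Arguments chart {R M I E} a i _.
Arguments chart_at {R M I E} a x.

(* Regularity is automatic for paracompact Hausdorff manifolds and for finite
   dimensional Hausdorff manifolds; in infinite dimension it is what makes
   every tangent vector extend to a continuous vector field. *)
Record banach_manifold (R : realType) := BanachManifold {
  bm_space :> topologicalType ;
  bm_index : Type ;
  bm_model : bm_index -> completeNormedModType R ;
  bm_atlas : atlas bm_space bm_model ;
  bm_hausdorff : hausdorff_space bm_space ;
  bm_regular : regular_space bm_space }.

(* The base point only supplies [g_sigma_algebraType] with the pointed type it
   requires; it is no restriction on a space carrying a probability measure. *)
Record smooth_manifold (R : realType) (n : nat) := SmoothManifold {
  sm_space :> ptopologicalType ;
  sm_index : Type ;
  sm_atlas : atlas sm_space (fun _ : sm_index => 'rV[R]_n) ;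
  sm_hausdorff : hausdorff_space sm_space ;
  sm_second_countable : @second_countable sm_space }.

Section calculus_on_manifolds.
Context {R : realType}.
Implicit Types M N : banach_manifold R.

(* T_xM, identified with the model space of the chart [chart_at x]. *)
Definition tangent M (x : M) : completeNormedModType R :=
  bm_model (chart_at (bm_atlas M) x).

Definition at_chart M (x : M) : M -> tangent x :=
  chart (bm_atlas M) (chart_at (bm_atlas M) x).

Definition at_chart_inv M (x : M) : tangent x -> M :=
  chart_inv (bm_atlas M) (chart_at (bm_atlas M) x).

Arguments at_chart_inv {M} x _.

(* Components of a tangent vector at [x] in an arbitrary chart around [x]. *)
Definition tangent_coord M (x : M) (i : bm_index M) (V : tangent x) :
    bm_model i :=
  'd (chart (bm_atlas M) i \o at_chart_inv x) (at_chart x x) V.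

Definition continuous_vfield M (V : forall x : M, tangent x) : Prop :=
  forall (i : bm_index M) (x : M), chart_dom (bm_atlas M) i x ->
    {for x, continuous (fun y => tangent_coord i (V y))}.

Definition dirderiv M (g : M -> R) (x : M) (V : tangent x) : R :=
  'D_V (g \o at_chart_inv x) (at_chart x x).

(* The charts of TM are the (y, v) with y in a chart of M, so the last condition
   is the continuity on TM of the map sending V to its derivative of [g]. *)
Definition continuously_gateaux M (g : M -> R) : Prop :=
  forall i : bm_index M,
  let gi := g \o chart_inv (bm_atlas M) i in
  let Ui := chart (bm_atlas M) i @` chart_dom (bm_atlas M) i in
  [/\ (forall y v, Ui y -> derivable gi y v),
      (forall y, Ui y -> scalar (fun v => 'D_v gi y))
    & (forall y v, Ui y ->
         {for (y, v), continuous
            (fun z : bm_model i * bm_model i => 'D_(z.2) gi z.1)})].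

Definition C1_map M N (f : M -> N) : Prop :=
  continuous f /\
  forall (i : bm_index M) (j : bm_index N),
    Cn_on 1 (chart (bm_atlas M) i @`
               (chart_dom (bm_atlas M) i `&` f @^-1` chart_dom (bm_atlas N) j))
            (chart (bm_atlas N) j \o f \o chart_inv (bm_atlas M) i).

(* An isomorphism for C^1 maps, the maps underlying Markov morphisms. *)
Definition diffeomorphism M N (f : M -> N) : Prop :=
  C1_map f /\ exists g : N -> M, [/\ cancel f g, cancel g f & C1_map g].

Definition tangent_map M N (f : M -> N) (x : M) (V : tangent x) :
    tangent (f x) :=
  'd (at_chart (f x) \o f \o at_chart_inv x) (at_chart x x) V.

End calculus_on_manifolds.

Section lebesgue_on_manifolds.
Context {R : realType} {n : nat}.

Definition box (a b : 'rV[R]_n) : set 'rV[R]_n :=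
  [set x | forall j, a ord0 j < x ord0 j <= b ord0 j].

Definition box_volume (a b : 'rV[R]_n) : R :=
  \prod_(j < n) Num.max 0 (b ord0 j - a ord0 j).

(* Index sets [K] rather than full sequences make this the counting measure
   when n = 0. *)
Definition lebesgue_outer (A : set 'rV[R]_n) : \bar R :=
  ereal_inf [set s | exists (K : set nat) (a b : nat -> 'rV[R]_n),
    A `<=` \bigcup_(k in K) box (a k) (b k) /\
    s = (\esum_(k in K) (box_volume (a k) (b k))%:E)%E].

Definition borel (Omega : smooth_manifold R n) :=
  g_sigma_algebraType (@open Omega).

(* Local equivalence with Lebesgue measure on R^n is mutual absolute continuity
   in every chart, hence only involves null sets. *)
Definition lebesgue_measure_on (Omega : smooth_manifold R n)
    (mu : {measure set (borel Omega) -> \bar R}) : Prop :=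
  forall (i : sm_index Omega) (A : set (borel Omega)),
    measurable A -> A `<=` chart_dom (sm_atlas Omega) i ->
    mu A = 0%E <-> lebesgue_outer (chart (sm_atlas Omega) i @` A) = 0%E.

End lebesgue_on_manifolds.

Section densities.
Context {R : realType} {d : measure_display} {T : measurableType d}.
Variable mu : {finite_measure set T -> \bar R}.

Definition is_density (phi : T -> R) (nu : probability T R) : Prop :=
  [/\ mu.-integrable setT (EFin \o phi),
      {ae mu, forall w, 0 < phi w}
    & forall A, measurable A -> nu A = (\int[mu]_(w in A) (phi w)%:E)%E].

(* [nu A] and the integral are compared on every measurable set, so a density
   automatically has integral 1. *)
Record Pplus := MkPplus {
  Pplus_prob :> probability T R ;
  Pplus_dominated : exists phi, is_density phi Pplus_prob }.

Definition density (nu : Pplus) : T -> R := sval (cid (Pplus_dominated nu)).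

Definition L1_continuous (M : topologicalType) (p : M -> Pplus) : Prop :=
  forall x : M,
    (fun y => \int[mu]_w `|density (p y) w - density (p x) w|) @ x --> (0 : R).

Context {M : banach_manifold R}.

Definition score (pbar : M -> T -> R) (x : M) (V : tangent x) : T -> R :=
  fun w => dirderiv (fun y => ln (pbar y w)) V.

(* Membership in [Lfun] asks the scores to be measurable everywhere and not just
   almost everywhere; this can be arranged by setting [pbar] to 1 on a
   measurable null set containing the exceptional points of the second clause,
   so it does not restrict the maps [p] admitting a potential. *)
Definition density_potential (k : R) (p : M -> Pplus) (pbar : M -> T -> R) :
    Prop :=
  [/\ (forall x, is_density (pbar x) (p x)),
      {ae mu, forall w, (forall x, 0 < pbar x w) /\
                        continuously_gateaux (fun x : M => ln (pbar x w))}
    & forall V : (forall x : M, tangent x), continuous_vfield V ->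
        (forall x, score pbar (V x) \in Lfun (p x) k%:E) /\
        continuous (fun x : M =>
          fine ('N[p x]_(k%:E)[EFin \o score pbar (V x)]))].

End densities.

Arguments Pplus {R d T} mu.
Arguments score {R d T M} pbar {x} V.

Record stat_model (R : realType) (M : banach_manifold R) (d : measure_display)
    (T : measurableType d) (mu : {finite_measure set T -> \bar R}) (k : R) :=
  StatModel {
    model_map :> M -> Pplus mu ;
    model_continuous : L1_continuous model_map ;
    model_potential : exists pbar, density_potential k model_map pbar }.

Section fisher.
Context {R : realType} {M : banach_manifold R} {d : measure_display}.
Context {T : measurableType d} {mu : {finite_measure set T -> \bar R}} {k : R}.

(* Two density potentials of the same model have the same scores p(x)-almost
   everywhere, so the Fisher form does not depend on this choice. *)
Definition potential (S : stat_model M mu k) : M -> T -> R :=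
  sval (cid (model_potential S)).

Definition model_score (S : stat_model M mu k) (x : M) (V : tangent x) :
    T -> R :=
  score (potential S) V.

Definition fisher (S : stat_model M mu k) (x : M) (V W : tangent x) : R :=
  \int[S x]_w (model_score S V w * model_score S W w).

End fisher.

Section markov.
Context {R : realType} {d1 d2 : measure_display}.
Context {T1 : measurableType d1} {T2 : measurableType d2}.

(* The Markov morphism T_* induced by a probability kernel. *)
Definition markov_push (K : R.-pker T1 ~> T2)
    (nu : {finite_measure set T1 -> \bar R}) (A : set T2) : \bar R :=
  (\int[nu]_w K w A)%E.

Definition positive_kernel (mu2 : probability T2 R) (Pi : T1 * T2 -> R) :
    Prop :=
  [/\ measurable_fun setT Pi,
      (forall z, 0 < Pi z)
    & forall w1, (\int[mu2]_w2 (Pi (w1, w2))%:E = 1)%E].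

Definition kernel_representable (mu2 : probability T2 R)
    (K : R.-pker T1 ~> T2) : Prop :=
  exists Pi, positive_kernel mu2 Pi /\
    forall (nu : {finite_measure set T1 -> \bar R}) (A : set T2),
      measurable A ->
      markov_push K nu A =
        (\int[nu]_w1 \int[mu2]_(w2 in A) (Pi (w1, w2))%:E)%E.

Definition restricted_markov_morphism (M : banach_manifold R)
    (mu1 : {finite_measure set T1 -> \bar R})
    (mu2 : {finite_measure set T2 -> \bar R}) (k : R)
    (S1 : stat_model M mu1 k) (S2 : stat_model M mu2 k)
    (f : M -> M) (K : R.-pker T1 ~> T2) : Prop :=
  C1_map f /\
  forall (x : M) (A : set T2), measurable A ->
    S2 (f x) A = markov_push K (S1 x) A.

Definition representable_morphism (M : banach_manifold R)
    (mu1 : probability T1 R) (mu2 : probability T2 R) (k : R)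
    (S1 : stat_model M mu1 k) (S2 : stat_model M mu2 k)
    (f : M -> M) (K : R.-pker T1 ~> T2) : Prop :=
  [/\ restricted_markov_morphism S1 S2 f K,
      diffeomorphism f
    & kernel_representable mu2 K].

End markov.

(* Omega_(n+1): indexing by [n.+1] leaves out the empty sample space. *)
Definition fin_sample (n : nat) := 'I_n.+1.

HB.instance Definition _ n := Choice.on (fin_sample n).
HB.instance Definition _ n := isPointed.Build (fin_sample n) ord0.
HB.instance Definition _ n := @isMeasurable.Build default_measure_display
  (fin_sample n) discrete_measurable discrete_measurable0
  discrete_measurableC discrete_measurableU.

Section uniform_fin_sample.
Context (R : realType) (n : nat).

Definition unif : set (fin_sample n) -> \bar R :=
  mscale ((n.+1%:R : R)^-1)%:nng counting.

HB.instance Definition _ := Measure.on unif.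

Let unif_setT : unif setT = 1%E.
Proof.
rewrite /unif /mscale /= /counting asboolT; last exact: finite_finset.
rewrite -EFinM; congr EFin.
rewrite (@card_fset_set _ _ n.+1) ?mulVf// ?pnatr_eq0//.
apply/card_set_bijP; exists val; split=> //=.
- by move=> x _; exact: ltn_ord.
- by move=> x y _ _; exact: val_inj.
- by move=> m mn; exists (Ordinal mn).
Qed.

HB.instance Definition _ := Measure_isProbability.Build _ _ _ unif unif_setT.

End uniform_fin_sample.

Arguments unif : clear implicits.

Section quadratic_form_fields.
Context {R : realType}.

Definition form_field (k : R) : Type :=
  forall (M : banach_manifold R) (n : nat) (S : stat_model M (unif R n) k)
    (x : M), tangent x -> tangent x -> R.

Context {k : R}.
Implicit Types F : form_field k.

Definition symmetric_bilinear_field F : Prop :=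
  forall (M : banach_manifold R) (n : nat) (S : stat_model M (unif R n) k)
    (x : M),
  bilinear_for *%R *%R (F M n S x) /\
  forall V W : tangent x, F M n S x V W = F M n S x W V.

(* The uniform measure charges every point, so that L^2(Omega_n, nu) is the
   space of all functions on Omega_n for every [nu] in P_+. *)
Definition local_field F : Prop :=
  exists Ft : forall n : nat, Pplus (unif R n) ->
      (fin_sample n -> R) -> (fin_sample n -> R) -> R,
    (forall n nu, bilinear_for *%R *%R (Ft n nu)) /\
    forall (M : banach_manifold R) (n : nat) (S : stat_model M (unif R n) k)
      (x : M) (V W : tangent x),
      F M n S x V W = Ft n (S x) (model_score S V) (model_score S W).

Definition weakly_continuous_field F : Prop :=
  forall (M : banach_manifold R) (n : nat) (S : stat_model M (unif R n) k)
    (V W : forall x : M, tangent x),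
  continuous_vfield V -> continuous_vfield W ->
  continuous (fun x => F M n S x (V x) (W x)).

Definition monotone_field F : Prop :=
  forall (M : banach_manifold R) (n1 n2 : nat)
    (S1 : stat_model M (unif R n1) k) (S2 : stat_model M (unif R n2) k)
    (f : M -> M) (K : R.-pker fin_sample n1 ~> fin_sample n2),
  representable_morphism S1 S2 f K ->
  forall (x : M) (V : tangent x),
    F M n2 S2 (f x) (tangent_map f V) (tangent_map f V) <= F M n1 S1 x V V.

Definition fisher_field : form_field k :=
  fun M n S x V W => fisher S V W.

End quadratic_form_fields.

(* Main.v *)
(* The Fisher form is four times the squared Hellinger speed of the model, and
   the Hellinger distance between densities is contracted by Markov kernels, by
   convexity of (sqrt p - sqrt q)^2. The speed of the target model is bounded
   below by Fatou's lemma. The speed of the source model is bounded above by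
   writing sqrt p_t - sqrt p_0 as a limit of Riemann sums of (score / 2) sqrt p_s
   and using Cauchy-Schwarz with the upper semicontinuity of the L^2 norms of
   scores; as k >= 2, the latter follows from the continuity of their L^k norms.

   Uniqueness is Chentsov's argument. Softmax families on R^(n+1) realize every
   point of the simplex and every tangent vector, so a monotone field is a
   quadratic form on the tangent spaces of the simplices that is monotone under
   positive kernels, and by weak continuity under all kernels. A kernel with a
   left inverse then preserves it. Permutations determine it at the uniform
   distributions up to a constant, splitting atoms into equal parts determines it
   at rational points with one constant for all sizes, and continuity does the
   rest. *)

Require Import Defs.
From HB Require Import structures.
From mathcomp Require Import all_boot all_order fingroup perm all_algebra.
From mathcomp Require Import all_classical all_reals all_analysis measurable_realfun.
From mathcomp Require Import ring lra zify.

Set Implicit Arguments.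
Unset Strict Implicit.
Unset Printing Implicit Defensive.

Import Order.TTheory GRing.Theory Num.Theory.
Import numFieldNormedType.Exports.

Local Open Scope classical_set_scope.
Local Open Scope ring_scope.

(** * Calculus in charts *)

(** The textbook argument, that the image score is a conditional expectation of the score,
    differentiates $\int\Pi p$ under the integral sign, and the hypotheses offer no integrable
    majorant for that. Half-densities avoid the exchange: $\sqrt p$ has derivative (score/2)$\sqrt
    p$, whence the factor 4, and each half of the comparison needs only a one-sided bound, which
    Fatou provides. Integrability of scores and continuity of their norms are assumed along
    continuous vector fields, while the claim concerns one tangent vector; hence the extension of a
    vector by a bump function. Differentiability is only Gâteaux, hence the mean value theorem on
    segments. In the uniqueness part morphisms have positive kernels, whereas splittings and
    coarse-grainings have zero entries; mixing with the uniform kernel approximates them. Source and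
    target share one manifold, so the target model is the image of the softmax family under the
    kernel, with [f] the identity. Vectors of sum zero occur throughout because scores have mean
    zero. *)

Section gateaux_calculus.
Context {R : realType}.

(** The two difference quotients are the same function of [h], so one-variable results (mean value
    theorem, chain rule for [expR] and [ln]) become available for directional derivatives. *)
Lemma is_derive_line (E F : normedModType R) (f : E -> F) (y v : E) (t : R)
    (l : F) :
  is_derive t 1 (fun s => f (y + s *: v)) l <-> is_derive (y + t *: v) v f l.
Proof.
have H : (fun h => h^-1 *: (f (h *: v + (y + t *: v)) - f (y + t *: v))) =
  (fun h => h^-1 *: (((fun s => f (y + s *: v)) \o shift t) (h *: (1 : R)) -
     f (y + t *: v))).
  apply/funext => h /=; congr (_ *: (f _ - _)).
  by rewrite [_%:A]mulr1 scalerDl addrCA.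
split=> -[D <-]; split.
- by rewrite /derivable H.
- by rewrite [RHS]/derive /= -H.
- by move: D; rewrite /derivable H.
- by rewrite /derive /= H.
Qed.

Lemma continuous_segment (f df : R -> R) (a b : R) :
  (forall x, a <= x <= b -> is_derive x 1 f (df x)) ->
  {within `[a, b], continuous f}.
Proof.
move=> h; apply: derivable_within_continuous => x.
by rewrite in_itv/= => /h [].
Qed.

Lemma MVT_line (E : normedModType R) (f : E -> R) (y v : E) :
  (forall t : R, 0 <= t <= 1 -> derivable f (y + t *: v) v) ->
  exists2 t : R, 0 < t < 1 & f (y + v) - f y = 'D_v f (y + t *: v).
Proof.
move=> dv.
have H (t : R) : 0 <= t <= 1 ->
    is_derive t 1 (fun s => f (y + s *: v)) ('D_v f (y + t *: v)).
  by move=> /dv ?; apply/is_derive_line; exact: derivableP.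
have H' (t : R) : t \in `]0, 1[%R ->
    is_derive t 1 (fun s => f (y + s *: v)) ('D_v f (y + t *: v)).
  by rewrite in_itv/= => /andP[t0 t1]; apply: H; rewrite !ltW.
have [t] := MVT ltr01 H' (continuous_segment H).
rewrite in_itv/= scale1r scale0r addr0 subr0 mulr1 => t01 ->.
by exists t.
Qed.

(** Chain rule with [h] only Gâteaux differentiable: by the mean value theorem the increment of [h]
    between two points of the curve is a derivative at an intermediate point in the direction
    [s *: q s], and joint continuity in point and direction gives the limit. *)
Lemma is_derive_gateaux_comp (E : normedModType R) (U : set E) (h : E -> R)
    (g : R -> E) (t : R) (w : E) :
  open U -> U (g t) ->
  (forall y v, U y -> derivable h y v) ->
  (forall y, U y -> scalar (fun v => 'D_v h y)) ->
  {for (g t, w), continuous (fun z : E * E => 'D_(z.2) h z.1)} ->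
  is_derive t 1 g w ->
  is_derive t 1 (h \o g) ('D_w h (g t)).
Proof.
move=> oU Ut dh lh ch [dg wE].
pose q s : E := s^-1 *: (g (s + t) - g t).
have qw : q s @[s --> 0^'] --> w.
  rewrite -wE /derive; move: dg; rewrite /derivable /=.
  have -> : (fun s => s^-1 *: (g (s *: (1 : R) + t) - g t)) = q.
    by apply/funext => s; rewrite [_%:A]mulr1.
  by [].
suff H : (fun s => s^-1 *: (h (g (s *: (1:R) + t)) - h (g t))) @ 0^' -->
    ('D_w h (g t)).
  split; first by apply/cvg_ex; exists ('D_w h (g t)).
  exact: cvg_lim H.
apply/cvgrPdist_lt => e e0.
have : \forall z \near (g t, w), `|'D_w h (g t) - 'D_(z.2) h z.1| < e.
  by move/cvgrPdist_lt : ch => /(_ e e0).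
move=> [[A B] /= [nA nB] AB].
have nAU : nbhs (g t) (A `&` U).
  by apply: filterI => //; exact: open_nbhs_nbhs.
(* A ball is convex, so the whole segment stays where [h] is differentiable and its derivative is
   controlled. *)
have /nbhs_ballP[d /= d0 dAU] := nAU.
have sq : `|s *: q s| @[s --> 0^'] --> (0 : R).
  rewrite [X in _ --> X](_ : _ = `|0 *: w|); last by rewrite scale0r normr0.
  apply: cvg_norm; apply: cvgZ qw.
  exact: (@cvg_within _ (nbhs (0 : R))).
near=> s.
have s0 : s != 0 by near: s; exact: nbhs_dnbhs_neq.
have sqd : `|s *: q s| < d.
  by near: s; move/cvgrPdist_lt : sq => /(_ _ d0); apply: filterS => s;
    rewrite sub0r normrN normr_id.
have gE : g (s *: (1 : R) + t) = g t + s *: q s.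
  by rewrite /q scalerA divff// scale1r [RHS]addrC subrK [_%:A]mulr1.
have inU (r : R) : 0 <= r <= 1 -> (A `&` U) (g t + r *: (s *: q s)).
  move=> /andP[r0 r1]; apply: dAU; rewrite -ball_normE/= opprD addrA subrr.
  rewrite sub0r normrN normrZ (le_lt_trans _ sqd)// ger0_norm// ler_piMl//.
have [r r01] := @MVT_line _ h (g t) (s *: q s)
  (fun r r01 => dh _ _ (inU r r01).2).
have r01' : 0 <= r <= 1 by case/andP: r01 => *; rewrite !ltW.
rewrite gE => ->.
have -> : 'D_(s *: q s) h (g t + r *: (s *: q s)) =
    s * 'D_(q s) h (g t + r *: (s *: q s)).
  have := lh _ (inU r r01').2 s (q s) 0.
  by rewrite addr0 derive0 addr0.
rewrite [_ *: _]mulKf//.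
apply: (AB (_, _)); split => /=; first exact: (inU r r01').1.
by near: s; exact: qw.
Unshelve. all: by end_near. Qed.

Lemma is_derive_gateaux_diff (E' E : normedModType R) (U : set E) (h : E -> R)
    (psi : E' -> E) (y w : E') :
  open U -> U (psi y) ->
  (forall y v, U y -> derivable h y v) ->
  (forall y, U y -> scalar (fun v => 'D_v h y)) ->
  {for (psi y, 'd psi y w), continuous (fun z : E * E => 'D_(z.2) h z.1)} ->
  differentiable psi y ->
  is_derive y w (h \o psi) ('D_('d psi y w) h (psi y)).
Proof.
move=> oU Uy dh lh ch dpsi.
have dp : is_derive (0 : R) 1 (fun s => psi (y + s *: w)) ('d psi y w).
  apply/is_derive_line; rewrite scale0r addr0; split.
    exact: diff_derivable.
  exact: deriveE.
have := @is_derive_gateaux_comp E U h (fun s => psi (y + s *: w)) 0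
  ('d psi y w) oU.
rewrite scale0r !addr0 => /(_ Uy dh lh ch dp) [].
move=> d1 d2; have := is_derive_line (h \o psi) y w 0 ('D_('d psi y w) h (psi y)).
by rewrite scale0r addr0 => -[+ _]; apply; apply: DeriveDef.
Qed.

Lemma is_derive_dirZ (f : R -> R) (x h l : R) :
  is_derive x 1 f l -> is_derive x h f (h * l).
Proof.
move=> [/derivable1_diffP df <-]; split; first exact: diff_derivable.
have -> : h = h *: (1 : R) by rewrite [RHS]mulr1.
by rewrite !deriveE// linearZ [h%:A]mulr1.
Qed.

(* Uniformity in x over [a, b] is what makes left Riemann sums converge. *)
Lemma uniform_growth_rate (f df : R -> R) (a b e : R) :
  0 < e ->
  (forall x, a <= x <= b -> \forall y \near x, is_derive (y : R) 1 f (df y)) ->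
  (forall x, a <= x <= b -> {for x, continuous df}) ->
  \forall h \near 0, forall x, a <= x <= b ->
    `|f (x + h) - f x - h * df x| <= e * `|h|.
Proof.
move=> e0 fd cd.
have := @segment_compact R a b => /compact_near_coveringP.
move=> /(_ R (nbhs (0 : R)) (fun h x => `|f (x + h) - f x - h * df x| <= e * `|h|)).
move=> /(_ _) H; suff /H : forall x, `[a, b]%classic x ->
    \forall x' \near x & h \near nbhs (0 : R),
     `|f (x' + h) - f x' - h * df x'| <= e * `|h|.
  by apply: filterS => h Hh x xab; apply: Hh; rewrite /= in_itv.
move=> x; rewrite /= in_itv/= => xab.
have e20 : 0 < e / 2 by rewrite divr_gt0.
have /nbhs_ballP[r /= r0 Hr] : \forall y \near x, is_derive (y : R) 1 f (df y) /\
    `|df x - df y| < e / 2.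
  near=> y; split; first by near: y; exact: fd.
  by near: y; have /cvgrPdist_lt/(_ _ e20) := cd x xab.
exists (ball x (r / 2), ball (0 : R) (r / 2)) => /=.
  by split; apply: nbhsx_ballx; rewrite divr_gt0.
move=> [y h] /= []; rewrite /ball/= sub0r normrN => yx hr.
have inb t : 0 <= t <= 1 -> ball x r (y + t *: h).
  move=> /andP[t0 t1]; rewrite /ball/= opprD addrA.
  rewrite (le_lt_trans (ler_normB _ _))//.
  rewrite [ltRHS](splitr r) ltrD// normrM (ger0_norm t0).
  by rewrite (le_lt_trans _ hr)// ler_piMl.
have D t : 0 <= t <= 1 -> derivable f (y + t *: h) h.
  by move=> /inb /Hr [/(is_derive_dirZ h)[]].
have [t t01 ->] := MVT_line D.
have t01' : 0 <= t <= 1 by case/andP: t01 => *; rewrite !ltW.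
have [D1 Dx1] := Hr _ (inb t t01').
have [_ Dx2] : is_derive y 1 f (df y) /\ `|df x - df y| < e / 2.
  by have := Hr _ (inb 0 _); rewrite scale0r addr0; apply; rewrite lexx ler01.
have -> : 'D_h f (y + t *: h) = h * df (y + t *: h).
  by case: (is_derive_dirZ h D1).
rewrite -mulrBr normrM mulrC ler_wpM2r//.
rewrite (_ : _ - _ = (df x - df y) - (df x - df (y + t *: h))); last by ring.
by rewrite (le_trans (ler_normB _ _))// (splitr e) lerD// ltW.
Unshelve. all: by end_near. Qed.

(** Telescope over the grid: each increment differs from its left rectangle by at most [e / (t + 1)]
    times the step, which adds up to at most [e]. Stating the limit as [f t - f 0] keeps integrals
    in the curve parameter out of the argument. *)
Lemma riemann_cvg (f df : R -> R) (t : R) :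
  0 <= t ->
  (forall x, 0 <= x <= t -> \forall y \near x, is_derive (y : R) 1 f (df y)) ->
  (forall x, 0 <= x <= t -> {for x, continuous df}) ->
  (t / n.+1%:R) * \sum_(j < n.+1) df (t * (j%:R / n.+1%:R)) @[n --> \oo] -->
  f t - f 0.
Proof.
move=> t0 fd cd.
apply/cvgrPdist_le => e e0.
have et0 : 0 < e / (t + 1) by rewrite divr_gt0// ltr_wpDl.
have tn : t / n.+1%:R @[n --> \oo] --> (0 : R).
  rewrite -[X in _ --> X](mulr0 t); apply: cvgMr.
  exact: cvg_harmonic.
have G := tn _ (uniform_growth_rate et0 fd cd).
near=> n.
have Gn : forall x, 0 <= x <= t ->
    `|f (x + t / n.+1%:R) - f x - t / n.+1%:R * df x| <=
    e / (t + 1) * `|t / n.+1%:R|.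
  by near: n; exact: G.
pose u (j : nat) := t * (j%:R / n.+1%:R).
have uS j : u j.+1 = u j + t / n.+1%:R.
  by rewrite /u -[j.+1]addn1 natrD mulrDl mulrDr mul1r.
have uT : u n.+1 = t by rewrite /u divff ?mulr1// pnatr_eq0.
have u0 : u 0%N = 0 by rewrite /u mul0r mulr0.
have -> : f t - f 0 = \sum_(j < n.+1) (f (u j.+1) - f (u j)).
  by rewrite -[in LHS]u0 -[in LHS]uT -(telescope_sumr (f \o u))// big_mkord.
rewrite mulr_sumr -sumrB (le_trans (ler_norm_sum _ _ _))//.
rewrite (@le_trans _ _ (\sum_(j < n.+1) e / (t + 1) * `|t / n.+1%:R|))//.
  apply: ler_sum => j _; rewrite uS; apply: Gn.
  rewrite /u mulr_ge0//= -[leRHS]mulr1 ler_wpM2l//.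
  by rewrite ler_pdivrMr// mul1r ler_nat ltnW.
rewrite sumr_const card_ord -[leLHS]mulr_natr -mulrA ger0_norm ?divr_ge0//.
rewrite divfK ?pnatr_eq0// -mulrA ler_piMr ?(ltW e0)//.
by rewrite mulrC ler_pdivrMr ?mul1r ?lerDl // ltr_wpDl.
Unshelve. all: by end_near. Qed.

End gateaux_calculus.

(** * Fréchet derivatives extracted from [Cn_on] *)

Section frechet.
Context {R : realType}.

Lemma frechet_is_diff (E F : normedModType R) (f : E -> F)
    (df : {linear E -> F}) (x : E) :
  continuous df ->
  (forall e : R, 0 < e ->
     \forall y \near x, `|f y - f x - df (y - x)| <= e * `|y - x|) ->
  is_diff x f df.
Proof.
move=> cdf fE.
have H : f \o shift x = cst (f x) + df +o_ 0 id.
  apply/eqaddoP => e e0; rewrite [\forall y \near _, _ <= _](near_shift x) /=.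
  rewrite sub0r.
  have := fE e e0; apply: filterS => y.
  rewrite /= -[(f \o _ - _) _]/(f (y - x + x) - (f x + df (y - x))).
  by rewrite subrK opprD addrA.
have dE := diff_unique cdf H.
split => //; apply/diff_locallyP; rewrite dE; split => //.
Qed.

(** At order 1, the expansion clause on the empty tuple is Fréchet differentiability with derivative
    [h => D x [:: h]], the bound on 1-tuples makes this linear map continuous, and the last clause
    makes it vary continuously. *)
Lemma Cn1_is_diff (E F : normedModType R) (U : set E) (f : E -> F) :
  open U -> Cn_on 1 U f ->
  (forall x, U x -> differentiable f x) /\
  (forall v x, U x -> {for x, continuous (fun y => 'd f y v)}).
Proof.
move=> oU [D [D0 Dlin Db Dd Dc]].
have isd x : U x -> is_diff x f (fun h => D x [:: h]).
  move=> Ux.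
  have lD : linear (fun h => D x [:: h]) by exact: (Dlin x Ux [::] [::]).
  pose L : {linear E -> F} :=
    HB.pack (fun h => D x [:: h]) (GRing.isLinear.Build R E F *:%R _ lD).
  have cL : continuous L.
    have [C HC] := Db x Ux 1%N (leqnn _).
    apply/linear_bounded_continuous/linear_boundedP; near=> r => v.
    apply: (le_trans (HC [tuple v])) => /=; rewrite big_seq1 ler_wpM2r//.
  apply: (@frechet_is_diff _ _ f L x cL) => e e0.
  have nU : \forall y \near x, U y by exact: open_nbhs_nbhs.
  near=> y.
  have Uy : U y by near: y.
  rewrite -(D0 _ Uy) -(D0 _ Ux).
  have : forall v : 0.-tuple E, `|D y v - D x v - D x (y - x :: v)| <=
      e * `|y - x| * \prod_(e0 <- v) `|e0|.
    by near: y; exact: Dd.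
  by move=> /(_ [tuple]); rewrite big_nil mulr1.
split=> [x /isd//|v x Ux]; apply/cvgrPdist_le => e e0.
have ev : 0 < e / (`|v| + 1) by rewrite divr_gt0// ltr_wpDl.
have nU : \forall y \near x, U y by exact: open_nbhs_nbhs.
near=> y.
have Uy : U y by near: y.
have -> : 'd f x v = D x [:: v] by rewrite (@diff_val _ _ _ _ _ _ _ (isd x Ux)).
have -> : 'd f y v = D y [:: v] by rewrite (@diff_val _ _ _ _ _ _ _ (isd y Uy)).
have : forall w : 1.-tuple E, `|D y w - D x w| <=
    e / (`|v| + 1) * \prod_(e0 <- w) `|e0|.
  by near: y; exact: Dc.
move=> /(_ [tuple v]); rewrite /= big_seq1 distrC => /le_trans; apply.
by rewrite -mulrA ler_piMr ?(ltW e0)// mulrC ler_pdivrMr ?mul1r ?lerDl//.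
Unshelve. all: by end_near. Qed.

End frechet.

(** * Tangent vectors and vector fields read in charts *)

Section manifold_calculus.
Context {R : realType} (M : banach_manifold R).
Local Notation A := (bm_atlas M).
Local Notation idx := (bm_index M).
Local Notation dom := (chart_dom A).
Local Notation ch := (chart A).
Local Notation inv := (chart_inv A).
Implicit Types (i j k : idx) (z : M).

Lemma nbhs_chart_dom i z : dom i z -> nbhs z (dom i).
Proof. by move=> iz; apply: open_nbhs_nbhs; split => //; exact: chart_dom_open. Qed.

Lemma near_chart i z (P : set M) : dom i z -> nbhs z P ->
  \forall y \near ch i z, [/\ (ch i @` dom i) y, ch i (inv i y) = y,
    dom i (inv i y) & P (inv i y)].
Proof.
move=> iz nP.
have iy : (ch i @` dom i) (ch i z) by exists z.
have : nbhs (ch i z) (ch i @` dom i).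
  by apply: open_nbhs_nbhs; split => //; exact: chart_im_open.
have ci : inv i @ ch i z --> inv i (ch i z) := chart_inv_continuous iy.
rewrite (chartK iz) in ci; have n1 := ci _ nP => n2; near=> y.
have [x ix xy] : (ch i @` dom i) y by near: y.
split; [by exists x| | |by near: y].
- by rewrite -xy (chartK ix).
- by rewrite -xy (chartK ix).
Unshelve. all: by end_near. Qed.

Lemma open_chart_image i (P : set M) : open P -> open (ch i @` (dom i `&` P)).
Proof.
move=> oP; rewrite openE => _ [z [iz Pz] <-].
have nP : nbhs z P by exact: open_nbhs_nbhs.
by apply: filterS (near_chart iz nP) => y [_ yE iy Py]; exists (inv i y).
Qed.

Lemma chart_transition_diff i j z : dom i z -> dom j z ->
  differentiable (ch j \o inv i) (ch i z) /\
  forall v, {for ch i z, continuous (fun y => 'd (ch j \o inv i) y v)}.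
Proof.
move=> iz jz; have oU := open_chart_image i (@chart_dom_open _ _ _ _ A j).
have [d c] := Cn1_is_diff oU (@chart_transition _ _ _ _ A i j 1%N).
have Uz : (ch i @` (dom i `&` dom j)) (ch i z) by exists z.
by split=> [|v]; [exact: d|exact: c].
Qed.

Lemma diff_chart_comp i j k z v : dom i z -> dom j z -> dom k z ->
  'd (ch k \o inv j) (ch j z) ('d (ch j \o inv i) (ch i z) v) =
  'd (ch k \o inv i) (ch i z) v.
Proof.
move=> iz jz kz.
have [dij _] := chart_transition_diff iz jz.
have [djk _] := chart_transition_diff jz kz.
have [dik _] := chart_transition_diff iz kz.
have zE : (ch j \o inv i) (ch i z) = ch j z by rewrite /= (chartK iz).
rewrite -zE in djk.
have H := congr1 (fun F : _ -> _ => F v) (diff_comp dij djk).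
transitivity ('d (ch k \o inv j) ((ch j \o inv i) (ch i z))
  ('d (ch j \o inv i) (ch i z) v)); first by rewrite zE.
apply: etrans (esym H) _.
apply: etrans (esym (deriveE v (differentiable_comp dij djk))) _.
apply: etrans _ (deriveE v dik).
apply: near_eq_derive; apply: filterS (near_chart iz (nbhs_chart_dom jz)).
by move=> y [_ _ _ jy] /=; rewrite (chartK jy).
Qed.

Section gateaux.
Variable g : M -> R.
Hypothesis gg : continuously_gateaux g.

(** Near [y] the composite factors through chart [j], where the Gâteaux chain rule applies. It
    serves with [psi] a chart inverse (change of chart) and with [psi] a chart inverse followed by
    [f] (image curves). *)
Lemma is_derive_chart_comp (E : normedModType R) j (psi : E -> M) (y w : E) :
  dom j (psi y) -> {for y, continuous psi} ->
  differentiable (ch j \o psi) y ->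
  is_derive y w (g \o psi)
    ('D_('d (ch j \o psi) y w) (g \o inv j) (ch j (psi y))).
Proof.
move=> jy cpsi dpsi; have [dg lg cg] := gg j.
have Uy : (ch j @` dom j) ((ch j \o psi) y) by exists (psi y).
have := is_derive_gateaux_diff (@chart_im_open _ _ _ _ A j) Uy dg lg
  (cg _ ('d (ch j \o psi) y w) Uy) dpsi.
have npsi : \forall z \near y, dom j (psi z).
  exact: cpsi _ (nbhs_chart_dom jy).
apply: near_eq_is_derive; apply: filterS npsi => z jz.
by rewrite /= (chartK jz).
Qed.

Lemma derive_change_chart i j z w : dom i z -> dom j z ->
  'D_('d (ch j \o inv i) (ch i z) w) (g \o inv j) (ch j z) =
  'D_w (g \o inv i) (ch i z).
Proof.
move=> iz jz; have zE : inv i (ch i z) = z by exact: chartK.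
have [dij _] := chart_transition_diff iz jz.
have := @is_derive_chart_comp _ j (inv i) (ch i z) w.
rewrite zE => /(_ jz _ dij) [|_ -> //].
by apply: chart_inv_continuous; exists z.
Qed.

Lemma dirderivE i z (V : tangent z) : dom i z ->
  dirderiv g V = 'D_(tangent_coord i V) (g \o inv i) (ch i z).
Proof.
move=> iz; rewrite /tangent_coord derive_change_chart//.
exact: chart_atP.
Qed.

Lemma dirderiv_linear z : scalar (fun V : tangent z => dirderiv g V).
Proof.
have [_ lg _] := gg (chart_at A z); apply: lg.
by exists z => //; exact: chart_atP.
Qed.

End gateaux.

(** [tangent z] is the model space of a chart chosen separately for each [z], with no continuity in
    [z]. This is the coordinate field of constant value [v] in chart [i], rewritten in those varying
    frames. *)
Definition chart_vector i z (v : bm_model i) : tangent z :=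
  'd (at_chart z \o inv i) (ch i z) v.

Lemma tangent_coord_chart_vector i j z (v : bm_model i) : dom i z -> dom j z ->
  tangent_coord j (chart_vector z v) = 'd (ch j \o inv i) (ch i z) v.
Proof. by move=> iz jz; apply: diff_chart_comp => //; exact: chart_atP. Qed.

Lemma dirderiv_chart_vector g i z (v : bm_model i) :
  continuously_gateaux g -> dom i z ->
  dirderiv g (chart_vector z v) = 'D_v (g \o inv i) (ch i z).
Proof.
by move=> gg iz; apply: derive_change_chart => //; exact: chart_atP.
Qed.

(* The bump function has closed support inside the chart by regularity of M. *)
Lemma vfield_extension i (x : M) (v : bm_model i) : dom i x ->
  exists X : forall z, tangent z, continuous_vfield X /\
    \forall z \near x, dom i z /\ X z = chart_vector z v.
Proof.
move=> ix.
have [N nN clN] := bm_regular (nbhs_chart_dom ix).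
have /nbhs_ballP[r /= r0 Hr] := near_chart ix nN.
pose q (y : bm_model i) := 2 / r * `|y - ch i x|.
(* Piecewise linear in [q]: it is 1 for [q <= 1] and 0 for [q >= 2], that is, 1 within [r / 2] of
   the centre and 0 beyond [r]. *)
pose psi (y : bm_model i) : R := (`|2 - q y| - `|1 - q y| + 1) / 2.
pose X z : tangent z := if `[< dom i z >] then
  psi (ch i z) *: chart_vector z v else 0.
have psi0 z : dom i z -> ~ closure N z -> psi (ch i z) = 0.
  move=> iz nz; have zr : r <= `|ch i z - ch i x|.
    rewrite leNgt; apply/negP => zr; apply: nz; apply: subset_closure.
    have : ball (ch i x) r (ch i z) by rewrite -ball_normE /= distrC.
    by move=> /Hr[_ _ _]; rewrite (chartK iz).
  have q2 : 2 <= q (ch i z).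
    by rewrite /q mulrAC ler_pdivlMr// ler_pM2l.
  by rewrite /psi !ler0_norm ?subr_le0// ?(le_trans _ q2)//; lra.
have X0 z : ~ closure N z -> X z = 0.
  by rewrite /X => nz; case: asboolP => // iz; rewrite psi0 ?scale0r.
exists X; split; last first.
  near=> z.
  have iz : dom i z by near: z; exact: nbhs_chart_dom.
  split => //; rewrite /X asboolT//.
  suff -> : psi (ch i z) = 1 by rewrite scale1r.
  have : `|ch i z - ch i x| < r / 2.
    near: z; have : 0 < r / 2 by rewrite divr_gt0.
    by have /cvgrPdist_lt H := chart_continuous ix => /H; apply: filterS => z;
      rewrite distrC.
  rewrite ltr_pdivlMr// mulrC => /ltW zr; have q1 : q (ch i z) <= 1.
    by rewrite /q mulrAC ler_pdivrMr// mul1r.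
  by rewrite /psi !ger0_norm ?subr_ge0// ?(le_trans q1)//; lra.
move=> j z jz.
(* Off the chart, [X] vanishes on the open complement of [closure N], which contains [z] because
   [closure N] lies in the chart. *)
have [iz|niz] := pselect (dom i z); last first.
  have nz : ~ closure N z by move=> /clN.
  have near0 : \forall y \near z, tangent_coord j (X y) = 0.
    have : nbhs z (~` closure N).
      by apply: open_nbhs_nbhs; split => //; exact/closed_openC/closed_closure.
    by apply: filterS => y /X0 ->; rewrite /tangent_coord linear0.
  suff : (fun y => tangent_coord j (X y)) @ z --> tangent_coord j (X z) by [].
  by rewrite (nbhs_singleton near0); apply: cvg_near_cst; exact: near0.
have nearE : \forall y \near z, psi (ch i y) *: 'd (ch j \o inv i) (ch i y) v =
    tangent_coord j (X y).
  near=> y.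
  have iy : dom i y by near: y; exact: nbhs_chart_dom.
  have jy : dom j y by near: y; exact: nbhs_chart_dom.
  rewrite /X asboolT// /tangent_coord linearZ/=; congr (_ *: _).
  by rewrite -tangent_coord_chart_vector.
suff : (fun y => tangent_coord j (X y)) @ z --> tangent_coord j (X z) by [].
rewrite -(nbhs_singleton nearE).
apply: cvg_trans; first exact: near_eq_cvg nearE.
have ci := chart_continuous iz.
apply: cvgZ.
  apply: (@continuous_comp _ _ _ (ch i) psi) => //.
  have cq : {for ch i z, continuous q}.
    apply: cvgMl_tmp; apply: cvg_norm; apply: cvgB; first exact: cvg_id.
    exact: cvg_cst.
  apply: cvgMr_tmp; apply: cvgD; last exact: cvg_cst.
  by apply: cvgB; apply: cvg_norm; apply: cvgB => //; exact: cvg_cst.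
have [_ c] := chart_transition_diff iz jz.
exact: (@continuous_comp _ _ _ (ch i) (fun y => 'd (ch j \o inv i) y v)).
Unshelve. all: by end_near. Qed.

End manifold_calculus.

(** * Hellinger distances and Markov kernels *)

Section integration.
Context {R : realType}.

Lemma limn_einf_le (u : (\bar R)^nat) (C : \bar R) :
  (forall n, (u n <= C)%E) -> (limn_einf u <= C)%E.
Proof.
move=> uC; rewrite limn_einf_lim; apply: lime_le; first exact: is_cvg_einfs.
by near=> n; apply: ge_ereal_inf => //; exists (u n) => //; exists n => /=.
Unshelve. all: by end_near. Qed.

(** The limit theorem under the integral sign for all of part 1: it is applied to Riemann sums, to
    difference quotients and to semicontinuity of score norms. *)
Lemma ae_fatou_le d (T : measurableType d) (mu : {measure set T -> \bar R})
    (f_ : nat -> T -> R) (f : T -> R) (C : \bar R) :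
  (forall n, measurable_fun setT (f_ n)) -> measurable_fun setT f ->
  (forall n w, 0 <= f_ n w) -> (forall w, 0 <= f w) ->
  {ae mu, forall w, f_ n w @[n --> \oo] --> f w} ->
  (forall n, (\int[mu]_w (f_ n w)%:E <= C)%E) ->
  (\int[mu]_w (f w)%:E <= C)%E.
Proof.
move=> mf_ mf f_0 f0 cf bf.
apply: (@le_trans _ _ (\int[mu]_w limn_einf (fun n => (f_ n w)%:E))%E).
  apply: ae_ge0_le_integral => //.
  - by move=> w _; rewrite lee_fin.
  - exact/measurable_EFinP.
  - move=> w _; rewrite limn_einf_lim; apply: lime_ge.
      exact: is_cvg_einfs.
    near=> n; apply: le_ereal_inf_tmp => _ [m _ <-].
    by rewrite lee_fin.
  - apply: measurableT_comp => //; apply: measurable_fun_limn_esup => n.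
    by apply: measurableT_comp => //; exact/measurable_EFinP.
  - apply: filterS cf => w cf _.
    have H : (fun n => (f_ n w)%:E) @ \oo --> (f w)%:E by apply: cvg_EFin => //; exact: nearW.
    by rewrite (cvg_limn_einf_sup H).1.
apply: le_trans (limn_einf_le bf).
apply: (@fatou _ _ _ mu setT measurableT (fun n w => (f_ n w)%:E)).
- by move=> n; exact/measurable_EFinP.
- by move=> n w _; rewrite lee_fin.
Unshelve. all: by end_near. Qed.

Lemma sqr_sum_le (I : Type) (s : seq I) (a : I -> R) :
  (\sum_(i <- s) a i) ^+ 2 <= (size s)%:R * \sum_(i <- s) a i ^+ 2.
Proof.
elim: s => [|x s IH]; first by rewrite !big_nil expr0n mul0r.
rewrite !big_cons /=; set S := \sum_(i <- s) a i in IH *.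
set Q := \sum_(i <- s) _ in IH *.
have Q0 : 0 <= Q by apply: sumr_ge0 => i _; exact: sqr_ge0.
have [s0|s0] := eqVneq (size s)%:R (0 : R).
  rewrite s0 mul0r in IH; have S0 : S = 0.
    by apply/eqP; rewrite -sqrf_eq0 eq_le IH sqr_ge0.
  by rewrite -natr1 s0 S0 add0r mul1r addr0 lerDl.
have {}s0 : 0 < (size s)%:R :> R by rewrite lt0r s0 ler0n.
have H : 2 * a x * S <= (size s)%:R * a x ^+ 2 + Q.
  rewrite -(ler_pM2l s0).
  have := sqr_ge0 ((size s)%:R * a x - S); nra.
rewrite -natr1; nra.
Qed.

(** An $L^2$ path of squared speed at most [C] moves by at most $t\sqrt C$. Riemann sums,
    Cauchy-Schwarz for finite sums and Fatou replace Minkowski's integral inequality, which would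
    ask for measurability jointly in parameter and sample point. *)
Lemma sqr_path_increment_le d (T : measurableType d)
    (mu : {measure set T -> \bar R}) (G dG : R -> T -> R) (t C : R) :
  0 <= t -> 0 <= C ->
  (forall s, 0 <= s <= t -> measurable_fun setT (G s)) ->
  (forall s, 0 <= s <= t -> measurable_fun setT (dG s)) ->
  {ae mu, forall w, forall s, 0 <= s <= t ->
     (\forall r \near s, is_derive (r : R) 1 (G^~ w) (dG r w)) /\
     {for s, continuous (dG^~ w)}} ->
  (forall s, 0 <= s <= t -> (\int[mu]_w (dG s w ^+ 2)%:E <= C%:E)%E) ->
  (\int[mu]_w ((G t w - G 0 w) ^+ 2)%:E <= (t ^+ 2 * C)%:E)%E.
Proof.
move=> t0 C0 mG mdG aeG bG.
pose u n (j : 'I_n.+1) : R := t * (j%:R / n.+1%:R).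
have u01 n j : 0 <= @u n j <= t.
  rewrite /u mulr_ge0 ?divr_ge0//= -[leRHS]mulr1 ler_wpM2l//.
  by rewrite ler_pdivrMr// mul1r ler_nat ltnW.
pose f_ n w := (t / n.+1%:R * \sum_(j < n.+1) dG (u n j) w) ^+ 2.
have t01 : 0 <= t <= t by rewrite t0 lexx.
have t00 : 0 <= (0 : R) <= t by rewrite t0 lexx.
apply: (@ae_fatou_le _ _ mu f_) => //.
- move=> n; apply: measurable_funX; apply: measurable_funM => //.
  by apply: measurable_sum => j; exact/mdG.
- by apply: measurable_funX; apply: measurable_funB; exact: mG.
- by move=> n w; exact: sqr_ge0.
- by move=> w; exact: sqr_ge0.
- apply: filterS aeG => w Gw; rewrite /f_.
  have H := @riemann_cvg _ (G^~ w) (dG^~ w) t t0 (fun s st => (Gw s st).1)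
    (fun s st => (Gw s st).2).
  by rewrite expr2; under eq_fun do rewrite expr2; exact: cvgM.
- move=> n.
  apply: (@le_trans _ _ (\int[mu]_w ((t ^+ 2 / n.+1%:R)%:E *
      \sum_(j < n.+1) (dG (u n j) w ^+ 2)%:E))%E).
    apply: ge0_le_integral => //.
    + by move=> w _; rewrite lee_fin sqr_ge0.
    + apply/measurable_EFinP/measurable_funX/measurable_funM => //.
      by apply: measurable_sum => j; exact: mdG.
    + apply: emeasurable_funM => //; apply: emeasurable_sum => j.
      by apply/measurable_EFinP/measurable_funX; exact: mdG.
    + move=> w _; rewrite sumEFin -EFinM lee_fin /f_ exprMn.
      have := sqr_sum_le (index_enum 'I_n.+1) (fun j => dG (u n j) w).
      have -> : size (index_enum 'I_n.+1) = n.+1.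
        by rewrite -[RHS](card_ord n.+1) cardT enumT.
      move=> /(ler_wpM2l (sqr_ge0 (t / n.+1%:R))) /le_trans; apply.
      set Q := \sum_(i <- _) _; set N := n.+1%:R.
      have N0 : N != 0 by rewrite pnatr_eq0.
      by rewrite le_eqVlt; apply/orP; left; apply/eqP; field.
  rewrite ge0_integralZl//; last 3 first.
  + apply: emeasurable_sum => j.
    by apply/measurable_EFinP/measurable_funX; exact: mdG.
  + by move=> w _; apply: sume_ge0 => j _; rewrite lee_fin sqr_ge0.
  + by rewrite lee_fin divr_ge0// sqr_ge0.
  rewrite ge0_integral_sum//; last 2 first.
  + by move=> j; apply/measurable_EFinP/measurable_funX; exact: mdG.
  + by move=> j w _; rewrite lee_fin sqr_ge0.
  apply: (@le_trans _ _ ((t ^+ 2 / n.+1%:R)%:E * \sum_(j < n.+1) C%:E)%E).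
    apply: lee_wpmul2l; first by rewrite lee_fin divr_ge0// sqr_ge0.
    by apply: lee_sum => j _; exact: bG.
  rewrite sumEFin -EFinM lee_fin sumr_const card_ord -[X in _ * X]mulr_natr.
  by rewrite -mulrA (mulrC _^-1) mulfK// pnatr_eq0.
Qed.

Section density_change.
Context d (T : measurableType d) (mu : {finite_measure set T -> \bar R}).

Lemma is_density_normr (phi : T -> R) (P : probability T R) :
  is_density mu phi P -> is_density mu (fun w => `|phi w|) P.
Proof.
move=> [iphi phi0 PE]; have mphi := measurable_int _ iphi.
split.
- exact: integrable_abse iphi.
- by apply: filterS phi0 => w w0; rewrite gtr0_norm.
- move=> A mA; rewrite PE//; apply: ae_eq_integral => //.
  + exact: measurable_funTS.
  + apply: measurable_funTS; apply/measurable_EFinP; apply: measurableT_comp => //.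
    exact/measurable_EFinP.
  + by apply: filterS phi0 => w w0 _; rewrite gtr0_norm.
Qed.

(** [phi] may fail to be positive on a null set, hence the absolute value. The Radon-Nikodym
    derivative satisfies the change of variables formula and agrees with [|phi|] almost everywhere,
    as both integrate to [P] on every measurable set. *)
Lemma integral_density (phi : T -> R) (P : probability T R) (h : T -> \bar R) :
  is_density mu phi P -> measurable_fun setT h -> (forall w, (0 <= h w)%E) ->
  (\int[P]_w h w = \int[mu]_w (h w * `|phi w|%:E))%E.
Proof.
move=> /is_density_normr[iphi _ PE] mh h0; have mphi := measurable_int _ iphi.
have dom : P `<< mu.
  apply/null_content_dominatesP => A mA A0; rewrite PE//.
  by apply: null_set_integral => //; exact: measurable_funTS.
rewrite -(Radon_Nikodym_SigmaFinite.change_of_variables dom)//.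
apply: ae_eq_integral => //.
- apply: emeasurable_funM => //; apply: measurable_int.
  exact: Radon_Nikodym_SigmaFinite.f_integrable.
- exact: emeasurable_funM.
- apply: ae_eqe_mul2l; apply: integral_ae_eq => //.
  + exact: Radon_Nikodym_SigmaFinite.f_integrable.
  + move=> E _ mE; rewrite -PE//.
    by rewrite -Radon_Nikodym_SigmaFinite.f_integral.
Qed.

End density_change.

End integration.

(** * Contraction of the Hellinger distance by positive kernels *)

Section hellinger.
Context {R : realType}.

(** [l] times the difference of the two sides is $(l\sqrt p-\sqrt{p'})^2$. Apart from the Hellinger
    term the bound is linear in [p] and [p'], so for fixed [l] it survives integration against a
    kernel. *)
Lemma hellinger_tangent (p p' l : R) : 0 <= p -> 0 <= p' -> 0 < l ->
  p + p' <= (Num.sqrt p - Num.sqrt p') ^+ 2 + l * p + l^-1 * p'.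
Proof.
move=> p0 p'0 l0; set a := Num.sqrt p; set b := Num.sqrt p'.
have aE : p = a ^+ 2 by rewrite sqr_sqrtr.
have bE : p' = b ^+ 2 by rewrite sqr_sqrtr.
rewrite aE bE -subr_ge0 -(pmulr_rge0 _ l0).
rewrite [X in 0 <= X](_ : _ = (l * a - b) ^+ 2) ?sqr_ge0//.
by field; rewrite gt_eqF.
Qed.

Context d1 d2 (T1 : measurableType d1) (T2 : measurableType d2).
Variables (mu1 : probability T1 R) (mu2 : probability T2 R).
Variable Pi : T1 * T2 -> R.
Hypothesis PiP : positive_kernel mu2 Pi.

Let mPi : measurable_fun setT Pi. Proof. by case: PiP. Qed.
Let Pi0 z : 0 <= Pi z. Proof. by case: PiP => _ + _; move=> /(_ z)/ltW. Qed.

Let mkernel_mul (g : T1 -> R) : measurable_fun setT g ->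
  measurable_fun setT (fun z : T1 * T2 => (Pi z * g z.1)%:E).
Proof.
move=> mg; apply/measurable_EFinP/measurable_funM => //.
exact: measurableT_comp.
Qed.

Lemma measurable_kernel_integral (g : T1 -> R) :
  measurable_fun setT g -> (forall w, 0 <= g w) ->
  measurable_fun setT (fun w2 => \int[mu1]_w1 (Pi (w1, w2) * g w1)%:E)%E.
Proof.
move=> mg g0; apply: (@measurable_fun_fubini_tonelli_G _ _ _ _ _ mu1
  (fun z : T1 * T2 => (Pi z * g z.1)%:E)).
- exact: mkernel_mul.
- by move=> z; rewrite lee_fin mulr_ge0.
Qed.

Lemma measurable_kernelr (w1 : T1) : measurable_fun setT (fun w2 => Pi (w1, w2)).
Proof. exact: measurableT_comp. Qed.

Lemma measurable_kernell (w2 : T2) : measurable_fun setT (fun w1 => Pi (w1, w2)).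
Proof. exact: measurableT_comp. Qed.

(* The dual description (sqrt q - sqrt q')^2 = max_l (1 - l) q + (1 - 1/l) q'
   makes the squared Hellinger distance jointly convex. *)
Lemma hellinger_markov_le (p p' : T1 -> R) (q q' : T2 -> R) :
  measurable_fun setT p -> measurable_fun setT p' ->
  measurable_fun setT q -> measurable_fun setT q' ->
  (forall w, 0 <= p w) -> (forall w, 0 <= p' w) ->
  {ae mu2, forall w2, [/\ 0 < q w2, 0 < q' w2,
     (\int[mu1]_w1 (Pi (w1, w2) * p w1)%:E = (q w2)%:E)%E &
     (\int[mu1]_w1 (Pi (w1, w2) * p' w1)%:E = (q' w2)%:E)%E]} ->
  (\int[mu2]_w ((Num.sqrt (q w) - Num.sqrt (q' w)) ^+ 2)%:E <=
   \int[mu1]_w ((Num.sqrt (p w) - Num.sqrt (p' w)) ^+ 2)%:E)%E.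
Proof.
move=> mp mp' mq mq' p0 p'0 aeq.
have msqrt d (T : measurableType d) (g : T -> R) :
    measurable_fun setT g -> measurable_fun setT (fun w => Num.sqrt (g w)).
  by move=> mg; apply: measurableT_comp => //; apply: continuous_measurable_fun;
    exact: sqrt_continuous.
pose g w := (Num.sqrt (p w) - Num.sqrt (p' w)) ^+ 2.
have mg : measurable_fun setT g.
  by apply/measurable_funX/measurable_funB; exact: msqrt.
have g0 w : 0 <= g w by exact: sqr_ge0.
apply: (@le_trans _ _ (\int[mu2]_w2 \int[mu1]_w1 (Pi (w1, w2) * g w1)%:E)%E).
  apply: ae_ge0_le_integral => //.
  - by move=> w _; rewrite lee_fin sqr_ge0.
  - apply/measurable_EFinP; apply/measurable_funX/measurable_funB; exact: msqrt.
  - by move=> w _; apply: integral_ge0 => w1 _; rewrite lee_fin mulr_ge0.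
  - exact: measurable_kernel_integral.
  apply: filterS aeq => w2 [qw q'w qE q'E] _.
  set a := Num.sqrt (q w2); set b := Num.sqrt (q' w2).
  have a0 : 0 < a by rewrite sqrtr_gt0.
  have b0 : 0 < b by rewrite sqrtr_gt0.
  (* The optimal multiplier: [l * q w2] and [l^-1 * q' w2] both become [a * b], so the integrated
     inequality bounds exactly $(a-b)^2$. *)
  pose l := b / a; have l0 : 0 < l by rewrite divr_gt0.
  have mk h : measurable_fun setT h ->
      measurable_fun setT (fun w1 => (Pi (w1, w2) * h w1)%:E).
    by move=> mh; apply/measurable_EFinP/measurable_funM => //;
      exact: measurable_kernell.
  have k0 h w1 : 0 <= h w1 -> (0 <= (Pi (w1, w2) * h w1)%:E)%E.
    by move=> h0; rewrite lee_fin mulr_ge0.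
  have : (\int[mu1]_w1 ((Pi (w1, w2) * p w1)%:E + (Pi (w1, w2) * p' w1)%:E) <=
      \int[mu1]_w1 ((Pi (w1, w2) * g w1)%:E +
        (l%:E * (Pi (w1, w2) * p w1)%:E + l^-1%:E * (Pi (w1, w2) * p' w1)%:E)))%E.
    apply: ge0_le_integral => //.
    - by move=> w1 _; rewrite adde_ge0// k0.
    - by apply: emeasurable_funD; exact: mk.
    - apply: emeasurable_funD; first exact: mk.
      by apply: emeasurable_funD; apply: emeasurable_funM => //; exact: mk.
    - move=> w1 _; rewrite -!EFinM -!EFinD lee_fin.
      have := ler_wpM2l (Pi0 (w1, w2)) (hellinger_tangent (p0 w1) (p'0 w1) l0).
      rewrite /g; set s := (_ ^+ 2); nra.
  rewrite ge0_integralD//; last 4 first.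
  - by move=> w1 _; exact: k0.
  - exact: mk.
  - by move=> w1 _; exact: k0.
  - exact: mk.
  rewrite ge0_integralD//; last 4 first.
  - by move=> w1 _; exact: k0.
  - exact: mk.
  - by move=> w1 _; rewrite adde_ge0// mule_ge0// ?k0// lee_fin ?invr_ge0 ltW.
  - by apply: emeasurable_funD; apply: emeasurable_funM => //; exact: mk.
  rewrite ge0_integralD//; last 4 first.
  - by move=> w1 _; rewrite mule_ge0// ?k0// lee_fin ltW.
  - by apply: emeasurable_funM => //; exact: mk.
  - by move=> w1 _; rewrite mule_ge0// ?k0// lee_fin invr_ge0 ltW.
  - by apply: emeasurable_funM => //; exact: mk.
  rewrite !ge0_integralZl//; last 6 first.
  - exact: mk.
  - by move=> w1 _; exact: k0.
  - by rewrite lee_fin invr_ge0 ltW.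
  - exact: mk.
  - by move=> w1 _; exact: k0.
  - by rewrite lee_fin ltW.
  rewrite qE q'E; case: (integral _ _ _) => [r| |]; rewrite ?leey//.
  rewrite -!EFinM -!EFinD !lee_fin => H.
  have aE : q w2 = a ^+ 2 by rewrite sqr_sqrtr// ltW.
  have bE : q' w2 = b ^+ 2 by rewrite sqr_sqrtr// ltW.
  move: H; rewrite aE bE (_ : l * a ^+ 2 = a * b) 1?(_ : l^-1 * b ^+ 2 = a * b).
  - by nra.
  - by rewrite /l; field; rewrite !gt_eqF.
  - by rewrite /l; field; rewrite !gt_eqF.
(* After the exchange the kernel integrates to 1 over [T2]. *)
rewrite -(@fubini_tonelli _ _ _ _ _ mu1 mu2 (fun z => (Pi z * g z.1)%:E)) /=.
- apply: ge0_le_integral => //.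
  + move=> w _; apply: integral_ge0 => w1 _; by rewrite lee_fin mulr_ge0.
  + apply: (@measurable_fun_fubini_tonelli_F _ _ _ _ _ mu2
      (fun z : T1 * T2 => (Pi z * g z.1)%:E)); first exact: mkernel_mul.
    by move=> z; rewrite lee_fin mulr_ge0.
  + exact/measurable_EFinP.
  + move=> w _; under eq_integral do rewrite mulrC EFinM.
    rewrite ge0_integralZl//; last 3 first.
    * by apply/measurable_EFinP; exact: measurable_kernelr.
    * by move=> w2 _; rewrite lee_fin.
    * by rewrite lee_fin.
    by have [_ _ ->] := PiP; rewrite mule1.
- exact: mkernel_mul.
- by move=> z; rewrite lee_fin mulr_ge0.
Qed.

(** By Tonelli both sides have the same integral on every measurable set. The absolute value makes
    the integrand non-negative everywhere, whereas [p] is positive only almost everywhere. *)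
Lemma markov_density_ae (p : T1 -> R) (q : T2 -> R)
    (P : probability T1 R) (Q : probability T2 R) :
  is_density mu1 p P -> is_density mu2 q Q ->
  (forall A, measurable A ->
    Q A = \int[P]_w1 \int[mu2]_(w2 in A) (Pi (w1, w2))%:E)%E ->
  {ae mu2, forall w2,
    (\int[mu1]_w1 (Pi (w1, w2) * `|p w1|)%:E = (q w2)%:E)%E}.
Proof.
move=> dp dq QE; have [ip _ _] := dp; have [iq _ qE] := dq.
have mp : measurable_fun setT p by apply/measurable_EFinP; exact: measurable_int ip.
have mnp : measurable_fun setT (fun w => `|p w|) by exact: measurableT_comp.
have : ae_eq mu2 setT (EFin \o q) (fun w2 => \int[mu1]_w1 (Pi (w1, w2) * `|p w1|)%:E)%E.
  apply: integral_ae_eq => //; first exact: measurable_kernel_integral.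
  move=> A _ mA; rewrite -qE// QE//.
  have restrE (h : T2 -> R) : (\int[mu2]_(w2 in A) (h w2)%:E =
      \int[mu2]_w2 (h w2 * \1_A w2)%:E)%E.
    rewrite integral_mkcond; apply: eq_integral => w2 _.
    by rewrite patchE indicE; case: (w2 \in A); rewrite ?mulr1// mulr0.
  pose PiA z := Pi z * \1_A z.2.
  have mPiA : measurable_fun setT PiA.
    by apply: measurable_funM => //; exact: measurableT_comp.
  have PiA0 z : 0 <= PiA z by rewrite mulr_ge0.
  transitivity (\int[P]_w1 \int[mu2]_w2 (PiA (w1, w2))%:E)%E.
    by apply: eq_integral => w1 _; exact: (restrE (fun w2 => Pi (w1, w2))).
  rewrite (integral_density dp); last 2 first.
  - apply: (@measurable_fun_fubini_tonelli_F _ _ _ _ _ mu2 (fun z => (PiA z)%:E)).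
      exact/measurable_EFinP.
    by move=> z; rewrite lee_fin.
  - by move=> w; apply: integral_ge0 => w2 _; rewrite lee_fin (PiA0 (w, w2)).
  transitivity (\int[mu1]_w1 \int[mu2]_w2 (PiA (w1, w2) * `|p w1|)%:E)%E.
    apply: eq_integral => w1 _; rewrite -ge0_integralZr//.
    - by apply/measurable_EFinP; apply: (measurableT_comp mPiA).
    - by move=> w2 _; rewrite lee_fin (PiA0 (w1, w2)).
  rewrite (@fubini_tonelli _ _ _ _ _ mu1 mu2
    (fun z : T1 * T2 => (PiA z * `|p z.1|)%:E)) /=; last 2 first.
  - apply/measurable_EFinP/measurable_funM => //.
    exact: (measurableT_comp mnp).
  - by move=> z; rewrite lee_fin mulr_ge0.
  rewrite [RHS]integral_mkcond; apply: eq_integral => w2 _.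
  rewrite patchE; case: ifP => w2A.
    by apply: eq_integral => w1 _; rewrite /PiA indicE/= w2A mulr1.
  by apply: integral0_eq => w1 _; rewrite /PiA indicE/= w2A mulr0 mul0r.
by apply: filterS => w H; rewrite -H.
Qed.

End hellinger.

(** * The Fisher form as Hellinger speed *)

Section score_along_curves.
Context {R : realType}.

(** Half-densities are handled as [expR (ln p / 2)], since [ln p] is what a model makes
    differentiable. *)
Lemma is_derive_expR_half (u : R -> R) (s du : R) :
  is_derive s 1 u du ->
  is_derive s 1 (fun r => expR (u r / 2)) (2^-1 * du * expR (u s / 2)).
Proof.
move=> us; have us2 : is_derive s 1 (fun r => 2^-1 * u r) (2^-1 * du).
  exact: is_deriveZ.
have := @is_derive1_comp _ expR (fun r => 2^-1 * u r) s _ _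
  (is_derive_expR _) us2.
rewrite mulrC [u s / 2]mulrC; congr (is_derive _ _ _ _).
by apply/funext => r /=; rewrite mulrC.
Qed.

Lemma sqrtr_expR (r : R) : Num.sqrt (expR r) = expR (r / 2).
Proof.
have -> : expR r = expR (r / 2) ^+ 2 by rewrite -expRM_natl mulrC divfK.
by rewrite sqrtr_sqr ger0_norm// expR_ge0.
Qed.

Context {M : banach_manifold R}.
Local Notation A := (bm_atlas M).
Local Notation dom := (chart_dom A).
Local Notation ch := (chart A).
Local Notation inv := (chart_inv A).

Lemma chart_vector_at (x : M) (V : tangent x) : chart_vector x V = V.
Proof.
have xx := chart_atP A x; have [dx _] := chart_transition_diff xx xx.
apply: etrans (esym (deriveE V dx)) _.
rewrite -[RHS](derive_id (ch (chart_at A x) x) V).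
apply: near_eq_derive.
by apply: filterS (near_chart xx (nbhs_chart_dom xx)) => y [].
Qed.

Definition chart_line (x : M) (V : tangent x) (s : R) : M :=
  inv (chart_at A x) (ch (chart_at A x) x + s *: V).

Lemma chart_line0 (x : M) (V : tangent x) : chart_line V 0 = x.
Proof. by rewrite /chart_line scale0r addr0 chartK//; exact: chart_atP. Qed.

Lemma near_chart_line (x : M) (V : tangent x) (P : set M) : nbhs x P ->
  \forall s \near (0 : R), [/\ dom (chart_at A x) (chart_line V s),
    ch (chart_at A x) (chart_line V s) = ch (chart_at A x) x + s *: V &
    P (chart_line V s)].
Proof.
move=> nP; have xx := chart_atP A x.
have cl : (ch (chart_at A x) x + s *: V) @[s --> (0 : R)] -->
    ch (chart_at A x) x.
  rewrite -[X in _ --> X]addr0 -(scale0r V); apply: cvgD; first exact: cvg_cst.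
  by apply: cvgZr_tmp; exact: cvg_id.
have n : \forall s \near (0 : R), let y := ch (chart_at A x) x + s *: V in
  [/\ (ch (chart_at A x) @` dom (chart_at A x)) y,
    ch (chart_at A x) (inv (chart_at A x) y) = y,
    dom (chart_at A x) (inv (chart_at A x) y) & P (inv (chart_at A x) y)].
  exact: cl _ (near_chart xx nP).
by apply: filterS n => s [_ yE iy Py].
Qed.

Lemma chart_line_continuous (x : M) (V : tangent x) :
  {for 0, continuous (chart_line V)}.
Proof.
move=> P; rewrite chart_line0 => /near_chart_line-/(_ V).
by apply: filterS => s [].
Qed.

(* X extends V along its chart line, so that scores of X are derivatives in s. *)
Lemma vfield_along_chart_line (x : M) (V : tangent x) :
  exists X : forall z, tangent z, [/\ continuous_vfield X, X x = V &
    \forall s \near (0 : R), forall g : M -> R, continuously_gateaux g ->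
      (\forall r \near s, is_derive (r : R) 1 (g \o chart_line V)
         (dirderiv g (X (chart_line V r)))) /\
      {for s, continuous (fun r => dirderiv g (X (chart_line V r)))}].
Proof.
have xx := chart_atP A x.
have [X [cX XE]] := vfield_extension (V : bm_model _) xx.
exists X; split => //.
  by have [_ ->] := nbhs_singleton XE; rewrite chart_vector_at.
apply: filterS (nbhs_interior (near_chart_line V XE)) => s nP.
move=> g gg; have [dg lg cg] := gg (chart_at A x).
have dirE : \forall r \near s,
    'D_V (g \o inv (chart_at A x)) (ch (chart_at A x) x + r *: V) =
    dirderiv g (X (chart_line V r)).
  apply: filterS nP => r [dr chr [_ ->]].
  by rewrite dirderiv_chart_vector// chr.
split.
  apply: filterS2 nP dirE => r [dr chr _] <-.
  apply: (@is_derive_line _ _ _ (g \o inv (chart_at A x))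
    (ch (chart_at A x) x) V r _).2.
  by apply/derivableP/dg; exists (chart_line V r).
suff : (fun r => dirderiv g (X (chart_line V r))) @ s -->
    dirderiv g (X (chart_line V s)) by [].
rewrite -(nbhs_singleton dirE).
apply: cvg_trans; first exact: near_eq_cvg dirE.
have [ds chs _] := nbhs_singleton nP.
have Us : (ch (chart_at A x) @` dom (chart_at A x)) (ch (chart_at A x) x + s *: V).
  by exists (chart_line V s).
apply: (@cvg_comp _ _ _ (fun r : R => (ch (chart_at A x) x + r *: V, V : bm_model _))
  (fun z => 'D_(z.2) (g \o inv (chart_at A x)) z.1) _ _ _ _ (cg _ V Us)).
apply: (@cvg_pair _ _ _ (nbhs s)); last exact: cvg_cst.
apply: cvgD; first exact: cvg_cst.
by apply: cvgZr_tmp; exact: cvg_id.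
Qed.

(** The image of a chart line under [f] need not be a chart line; the derivative at 0 suffices,
    because the bound on the target form uses difference quotients at 0 alone. *)
Lemma is_derive_chart_line_comp (f : M -> M) (x : M) (V : tangent x) (g : M -> R) :
  C1_map f -> continuously_gateaux g ->
  is_derive (0 : R) 1 (g \o f \o chart_line V) (dirderiv g (tangent_map f V)).
Proof.
move=> [cf f1] gg; have xx := chart_atP A x; have yy := chart_atP A (f x).
apply: (@is_derive_line _ _ _ (g \o (f \o inv (chart_at A x)))
  (ch (chart_at A x) x) V 0 _).2.
rewrite scale0r addr0.
have ix : inv (chart_at A x) (ch (chart_at A x) x) = x by exact: chartK.
have fo : open (f @^-1` dom (chart_at A (f x))).
  by apply: open_comp => [y _|]; [exact: cf|exact: chart_dom_open].
have oU := @open_chart_image _ _ (chart_at A x) _ fo.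
have [d _] := Cn1_is_diff oU (f1 (chart_at A x) (chart_at A (f x))).
have := @is_derive_chart_comp _ _ g gg _ (chart_at A (f x)) (f \o inv (chart_at A x))
  (ch (chart_at A x) x) V.
rewrite /= ix => /(_ yy); apply.
- apply: continuous_comp; last by rewrite ix; exact: cf.
  by apply: chart_inv_continuous; exists x.
- by apply: d; exists x.
Qed.

End score_along_curves.

Lemma is_derive_continuous (R : realType) (f : R -> R) (s l : R) :
  is_derive s 1 f l -> {for s, continuous f}.
Proof. by move=> [/derivable1_diffP/differentiable_continuous]. Qed.

Section model_hellinger.
Context {R : realType} {M : banach_manifold R} {d : measure_display}.
Context {T : measurableType d} {mu : {finite_measure set T -> \bar R}} {k : R}.
Variable S : stat_model M mu k.
Local Notation pbar := (potential S).

Lemma potentialP : density_potential k S pbar.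
Proof. exact: svalP. Qed.

Lemma measurable_potential (x : M) : measurable_fun setT (pbar x).
Proof.
by apply/measurable_EFinP; have [/(_ x)[ip _ _] _ _] := potentialP; exact: measurable_int ip.
Qed.

(** A model asserts measurability only for scores of continuous vector fields, so [V] is extended to
    one. *)
Lemma measurable_model_score (x : M) (V : tangent x) :
  measurable_fun setT (model_score S V).
Proof.
have [X [cX <- _]] := vfield_along_chart_line V.
have [_ _ /(_ X cX) [/(_ x) + _]] := potentialP.
by move=> /sub_Lfun_mfun; rewrite inE.
Qed.

Lemma integral_model (x : M) (h : T -> \bar R) :
  measurable_fun setT h -> (forall w, 0 <= h w)%E ->
  (\int[S x]_w h w = \int[mu]_w (h w * `|pbar x w|%:E))%E.
Proof. by move=> mh h0; apply: integral_density => //; have [+ _ _] := potentialP. Qed.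

Definition score_sqr (x : M) (V : tangent x) : \bar R :=
  (\int[S x]_w (model_score S V w ^+ 2)%:E)%E.

Lemma fisher_diag (x : M) (V : tangent x) : fisher S V V = fine (score_sqr V).
Proof. by []. Qed.

Lemma score_sqr_ge0 (x : M) (V : tangent x) : (0 <= score_sqr V)%E.
Proof. by apply: integral_ge0 => w _; rewrite lee_fin sqr_ge0. Qed.

Lemma fisher_ge0 (x : M) (V : tangent x) : 0 <= fisher S V V.
Proof. by rewrite fisher_diag fine_ge0// score_sqr_ge0. Qed.

(** The half-density $\sqrt p$, whose $L^2(\mu)$ distance is the Hellinger distance. The absolute
    value matches [integral_density]. *)
Definition root_density (x : M) (w : T) : R := Num.sqrt `|pbar x w|.

Lemma measurable_root_density (x : M) : measurable_fun setT (root_density x).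
Proof.
apply: measurableT_comp; last first.
  by apply: measurableT_comp => //; exact: measurable_potential.
by apply: continuous_measurable_fun; exact: sqrt_continuous.
Qed.

Lemma root_densityE (x : M) (w : T) : 0 < pbar x w ->
  root_density x w = expR (ln (pbar x w) / 2).
Proof. by move=> p0; rewrite -sqrtr_expR lnK// /root_density gtr0_norm. Qed.

Lemma sqr_root_density (x : M) (w : T) : root_density x w ^+ 2 = `|pbar x w|.
Proof. by rewrite sqr_sqrtr. Qed.

(** Isolated as a property because it has two sources: continuity of the $L^k$ norms for [2 <= k],
    and finiteness of the sample space. *)
Definition score_usc := forall X : (forall z : M, tangent z),
  continuous_vfield X -> forall c : R -> M, {for 0, continuous c} ->
  forall e : R, 0 < e -> \forall s \near (0 : R),
    (score_sqr (X (c s)) <= (fisher S (X (c 0)) (X (c 0)) + e)%:E)%E.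

(* The upper half of "squared Hellinger speed = Fisher form / 4"; the lower half,
   score_sqr_le_hellinger, needs no control of nearby scores. *)
Lemma hellinger_chart_line_le (x : M) (V : tangent x) (e : R) :
  score_usc -> 0 < e -> exists2 r : R, 0 < r & forall t, 0 < t < r ->
    (\int[mu]_w ((root_density (chart_line V t) w - root_density x w) ^+ 2)%:E <=
     (t ^+ 2 * ((fisher S V V + e) / 4))%:E)%E.
Proof.
move=> usc e0; have [X [cX XxV Xd]] := vfield_along_chart_line V.
have E0 : fisher S (X (chart_line V 0)) (X (chart_line V 0)) = fisher S V V.
  by rewrite -XxV; congr (fisher S (X _) (X _)); exact: chart_line0.
have := usc X cX _ (@chart_line_continuous _ _ x V) e e0.
rewrite E0 => usc0.
have [r /= r0 Hr] := (@nbhs_ballP _ R^o _ _).1 (filterI Xd usc0).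
exists r => // t /andP[t0 tr].
rewrite (_ : root_density x = root_density (chart_line V 0)); last first.
  by rewrite chart_line0.
have inr s : 0 <= s <= t -> ball (0 : R) r s.
  by move=> /andP[s0 st]; rewrite /ball/= sub0r normrN ger0_norm// (le_lt_trans st).
pose G s w := root_density (chart_line V s) w.
(* The derivative in [s] of the half-density; its squared $L^2(\mu)$ norm is a quarter of
   [score_sqr]. *)
pose dG s w := 2^-1 * model_score S (X (chart_line V s)) w * G s w.
apply: (@sqr_path_increment_le _ _ _ mu G dG) => //.
- exact: ltW.
- by rewrite divr_ge0// addr_ge0 ?fisher_ge0// ltW.
- by move=> s _; exact: measurable_root_density.
- move=> s _; apply: measurable_funM; last exact: measurable_root_density.
  by apply: measurable_funM => //; exact: measurable_model_score.
- have [_ ae _] := potentialP; apply: filterS ae => w [pw gw] s /inr /Hr [Ds _].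
  have [D1 D2] := Ds _ gw.
  have GE r' : G r' w = expR (ln (pbar (chart_line V r') w) / 2).
    by rewrite /G root_densityE.
  have D3 : \forall r \near s, is_derive (r : R) 1 (G^~ w) (dG r w).
    apply: filterS D1 => r' /is_derive_expR_half.
    by rewrite /dG GE; congr (is_derive _ _ _ _); apply/funext => r''; rewrite GE.
  split => //; apply: cvgM.
    by apply: cvgM; [exact: cvg_cst|exact: D2].
  exact: is_derive_continuous (nbhs_singleton D3).
- move=> s /inr /Hr [_ bs].
  have -> : (\int[mu]_w (dG s w ^+ 2)%:E =
      \int[mu]_w ((4^-1)%:E * ((model_score S (X (chart_line V s)) w ^+ 2)%:E *
        `|pbar (chart_line V s) w|%:E)))%E.
    apply: eq_integral => w _; rewrite -!EFinM; congr (_%:E).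
    rewrite -sqr_root_density /dG !exprMn mulrA; congr (_ * _ * _).
    by field.
  have ms := measurable_model_score (X (chart_line V s)).
  rewrite ge0_integralZl//; last 2 first.
  + apply: emeasurable_funM; apply/measurable_EFinP; first exact: measurable_funX.
    by apply: measurableT_comp => //; exact: measurable_potential.
  + by move=> w _; rewrite -EFinM lee_fin mulr_ge0// sqr_ge0.
  rewrite -integral_model; last 2 first.
  + exact/measurable_EFinP/measurable_funX.
  + by move=> w; rewrite lee_fin sqr_ge0.
  by rewrite mulrC EFinM; apply: lee_wpmul2l.
Qed.

(** Along [t n] tending to 0 the squared difference quotients of the half-density converge almost
    everywhere to a quarter of score squared times density, and Fatou carries the bound to the
    limit. The map [f] is built in because the target curve is the image of a chart line of the
    source. *)
Lemma score_sqr_le_hellinger (f : M -> M) (x : M) (V : tangent x) (C r : R) :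
  C1_map f -> 0 < r ->
  (forall t, 0 < t < r ->
    (\int[mu]_w ((root_density (f (chart_line V t)) w -
                  root_density (f x) w) ^+ 2)%:E <= (t ^+ 2 * C)%:E)%E) ->
  (score_sqr (tangent_map f V) <= (4 * C)%:E)%E.
Proof.
(* Halving keeps [t 0] strictly below [r]. *)
move=> f1 r0 HC; pose t n := r / 2 / n.+1%:R.
have t0 n : 0 < t n by rewrite !divr_gt0.
have tr n : 0 < t n < r.
  rewrite t0/= /t ltr_pdivrMr// ltr_pdivrMr// -mulrA ltr_pMr//.
  by rewrite -natrM ltr1n muln2 -addnn addnS.
pose f_ n w := ((root_density (f (chart_line V (t n))) w -
  root_density (f x) w) / t n) ^+ 2.
pose sc := model_score S (tangent_map f V).
have msc : measurable_fun setT sc by exact: measurable_model_score.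
have H : (\int[mu]_w ((2^-1 * sc w * root_density (f x) w) ^+ 2)%:E <= C%:E)%E.
  apply: (@ae_fatou_le _ _ _ mu f_) => //.
  - move=> n; apply/measurable_funX/measurable_funM => //.
    by apply: measurable_funB; exact: measurable_root_density.
  - apply/measurable_funX/measurable_funM; last exact: measurable_root_density.
    exact: measurable_funM.
  - by move=> n w; exact: sqr_ge0.
  - by move=> w; exact: sqr_ge0.
  - have [_ ae _] := potentialP; apply: filterS ae => w [pw gw].
    have D := is_derive_expR_half (is_derive_chart_line_comp V f1 gw).
    have {D}D : is_derive (0 : R) 1 (fun s => root_density (f (chart_line V s)) w)
        (2^-1 * sc w * root_density (f x) w).
      move: D; rewrite /= chart_line0 -root_densityE//.
      congr (is_derive _ _ _ _); apply/funext => s /=.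
      by rewrite root_densityE.
    have tc : t n @[n --> \oo] --> 0^'.
      have tn : t n @[n --> \oo] --> (0 : R).
        rewrite -[X in _ --> X](mulr0 (r / 2)); apply: cvgMr.
        exact: cvg_harmonic.
      move=> P nP; have n1 : \forall n \near \oo, t n != 0 -> P (t n) := tn _ nP.
      by apply: filterS n1 => n; apply; rewrite gt_eqF.
    have q : (fun h => h^-1 * (root_density (f (chart_line V h)) w -
        root_density (f x) w)) @ 0^' --> 2^-1 * sc w * root_density (f x) w.
      have [+ <-] := D; rewrite /derivable /derive.
      rewrite (_ : (fun h => _) = (fun h => h^-1 *
        (root_density (f (chart_line V h)) w - root_density (f x) w)))//.
      apply/funext => h /=.
      by rewrite addr0 [_%:A]mulr1 chart_line0.
    have {}q := cvg_comp _ _ tc q.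
    rewrite expr2 /f_; under eq_fun do rewrite expr2 mulrC.
    by apply: cvgM; under eq_fun do rewrite mulrC; exact: q.
  - move=> n.
    have mh : measurable_fun setT (fun w => (root_density (f (chart_line V (t n))) w -
        root_density (f x) w) ^+ 2).
      by apply/measurable_funX/measurable_funB; exact: measurable_root_density.
    rewrite (_ : \int[mu]_w (f_ n w)%:E = \int[mu]_w ((t n ^- 2)%:E *
        ((root_density (f (chart_line V (t n))) w -
          root_density (f x) w) ^+ 2)%:E))%E; last first.
      by apply: eq_integral => w _; rewrite -EFinM /f_ expr_div_n mulrC.
    rewrite ge0_integralZl//; last 3 first.
    + exact/measurable_EFinP.
    + by move=> w _; rewrite lee_fin sqr_ge0.
    + by rewrite lee_fin invr_ge0 sqr_ge0.
    apply: (@le_trans _ _ ((t n ^- 2)%:E * (t n ^+ 2 * C)%:E)%E).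
      by apply: lee_wpmul2l; [rewrite lee_fin invr_ge0 sqr_ge0|exact: HC].
    by rewrite -EFinM mulKf// sqrf_eq0 gt_eqF.
rewrite /score_sqr integral_model; last 2 first.
- exact/measurable_EFinP/measurable_funX.
- by move=> w; rewrite lee_fin sqr_ge0.
have -> : (\int[mu]_w ((sc w ^+ 2)%:E * `|pbar (f x) w|%:E) =
    \int[mu]_w (4%:E * ((2^-1 * sc w * root_density (f x) w) ^+ 2)%:E))%E.
  apply: eq_integral => w _; rewrite -!EFinM; congr (_%:E).
  by rewrite !exprMn sqr_root_density; field.
rewrite ge0_integralZl//; last 2 first.
- apply/measurable_EFinP/measurable_funX/measurable_funM.
    exact: measurable_funM.
  exact: measurable_root_density.
- by move=> w _; rewrite lee_fin sqr_ge0.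
by rewrite EFinM; apply: lee_wpmul2l.
Qed.

End model_hellinger.

(** For small [t], $4/t^2$ times the squared Hellinger displacement of the source is at most its
    Fisher form plus [e]; the kernel contracts the displacement, and in the limit the target form is
    below the same bound. *)
Lemma fisher_monotone (R : realType) (M : banach_manifold R) (k : R)
    (d1 d2 : measure_display) (T1 : measurableType d1) (T2 : measurableType d2)
    (mu1 : probability T1 R) (mu2 : probability T2 R)
    (S1 : stat_model M mu1 k) (S2 : stat_model M mu2 k)
    (f : M -> M) (K : R.-pker T1 ~> T2) (x : M) (V : tangent x) :
  score_usc S1 -> representable_morphism S1 S2 f K ->
  fisher S2 (tangent_map f V) (tangent_map f V) <= fisher S1 V V.
Proof.
move=> usc [[f1 fK] _ [Pi [PiP PiK]]].
have QE z A : measurable A -> S2 (f z) A =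
    (\int[S1 z]_w1 \int[mu2]_(w2 in A) (Pi (w1, w2))%:E)%E.
  by move=> mA; rewrite fK// PiK.
have ae z : {ae mu2, forall w2, 0 < potential S2 (f z) w2 /\
    (\int[mu1]_w1 (Pi (w1, w2) * `|potential S1 z w1|)%:E =
     (potential S2 (f z) w2)%:E)%E}.
  have [/(_ z) d1z _ _] := potentialP S1.
  have [/(_ (f z)) d2z _ _] := potentialP S2.
  have [_ p0 _] := d2z.
  have := markov_density_ae PiP d1z d2z (QE z).
  by apply: filterS2 p0 => w.
have hell z z' : (\int[mu2]_w ((root_density S2 (f z) w -
      root_density S2 (f z') w) ^+ 2)%:E <=
    \int[mu1]_w ((root_density S1 z w - root_density S1 z' w) ^+ 2)%:E)%E.
  have mn d (T : measurableType d) (g : T -> R) :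
      measurable_fun setT g -> measurable_fun setT (fun w => `|g w|).
    by move=> mg; exact: measurableT_comp.
  apply: (hellinger_markov_le PiP); try exact/mn/measurable_potential;
    rewrite //.
  by apply: filterS2 (ae z) (ae z') => w [q0 qE] [q'0 q'E]; rewrite !gtr0_norm.
apply/ler_addgt0Pr => e e0.
have [r r0 Hr] := hellinger_chart_line_le V usc e0.
have := @score_sqr_le_hellinger _ _ _ _ _ _ S2 f x V _ r f1 r0
  (fun t tr => le_trans (hell _ _) (Hr t tr)).
have -> : 4 * ((fisher S1 V V + e) / 4) = fisher S1 V V + e by field.
(* [fine] would turn an infinite value into 0; the real upper bound excludes that case. *)
rewrite [X in _ -> X <= _]fisher_diag; have := score_sqr_ge0 S2 (tangent_map f V).
by case: (score_sqr _ _) => [s| |]//; rewrite lee_fin.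
Qed.

(** * Continuity from continuous Gâteaux differentiability *)

Section gateaux_continuity.
Context {R : realType} {M : banach_manifold R}.
Variable g : M -> R.
Hypothesis gg : continuously_gateaux g.

(** In the mean value theorem the direction is the increment [v] itself. The derivative in direction
    0 vanishes, so continuity at the pair (centre, 0) makes the increment of [h] small. *)
Lemma gateaux_continuous : continuous g.
Proof.
move=> z; set A := bm_atlas M; pose i := chart_at A z.
have iz : chart_dom A i z := chart_atP A z.
have [dg lg cg] := gg i; set h := g \o chart_inv A i in dg lg cg.
set U := chart A i @` chart_dom A i in dg lg cg.
have Uz : U (chart A i z) by exists z.
have nU : nbhs (chart A i z) U.
  by apply: open_nbhs_nbhs; split => //; exact: chart_im_open.
suff ch : {for chart A i z, continuous h}.
  have hE : \forall y \near z, h (chart A i y) = g y.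
    by apply: filterS (nbhs_chart_dom iz) => y iy; rewrite /h/= (chartK iy).
  suff : g @ z --> g z by [].
  rewrite -(nbhs_singleton hE); apply: cvg_trans; first exact: near_eq_cvg hE.
  exact: (@continuous_comp _ _ _ (chart A i) h) (chart_continuous iz) ch.
suff : h @ chart A i z --> h (chart A i z) by [].
apply/cvgrPdist_le => e e0.
have := cg _ 0 Uz => /cvgrPdist_lt/(_ e e0); rewrite derive0.
move=> [[P Q] /= [nP nQ] PQ].
have [r /= r0 Hr] := (nbhs_ballP _ _).1 (filterI nP nU).
have [q /= q0 Hq] := (nbhs_ballP _ _).1 nQ.
apply/nbhs_ballP; exists (Num.min r q) => /=; first by rewrite lt_min r0.
move=> y; rewrite -ball_normE/= lt_min => /andP[yr yq].
pose v := y - chart A i z; have yE : y = chart A i z + v by rewrite addrC subrK.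
have inb (t : R) : 0 <= t <= 1 -> (P `&` U) (chart A i z + t *: v).
  move=> /andP[t0 t1]; apply: Hr; rewrite -ball_normE/= opprD addrA subrr.
  rewrite sub0r normrN normrZ ger0_norm// (le_lt_trans _ yr)//.
  by rewrite distrC ler_piMl.
have [t t01] := @MVT_line _ _ h (chart A i z) v (fun t t01 => dg _ v (inb t t01).2).
rewrite distrC -yE => ->.
have Qv : Q v by apply: Hq; rewrite -ball_normE/= sub0r normrN distrC.
have t01' : 0 <= t <= 1 by case/andP: t01 => *; rewrite !ltW.
have := PQ (_, _) (conj (inb t t01').1 Qv).
by rewrite /= sub0r normrN => /ltW.
Qed.

Lemma dirderiv_continuous (X : forall z : M, tangent z) :
  continuous_vfield X -> continuous (fun z => dirderiv g (X z)).
Proof.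
move=> cX z; set A := bm_atlas M; pose i := chart_at A z.
have iz : chart_dom A i z := chart_atP A z.
have [_ _ cg] := gg i.
have dE : \forall y \near z, 'D_(tangent_coord i (X y)) (g \o chart_inv A i)
    (chart A i y) = dirderiv g (X y).
  by apply: filterS (nbhs_chart_dom iz) => y iy; rewrite (dirderivE gg _ iy).
suff : (fun y => dirderiv g (X y)) @ z --> dirderiv g (X z) by [].
rewrite -(nbhs_singleton dE); apply: cvg_trans; first exact: near_eq_cvg dE.
have Uz : (chart A i @` chart_dom A i) (chart A i z) by exists z.
apply: (@cvg_comp _ _ _ (fun y => (chart A i y, tangent_coord i (X y)))
  (fun z => 'D_(z.2) (g \o chart_inv A i) z.1) _ _ _ _
  (cg _ (tangent_coord i (X z)) Uz)).
apply: (@cvg_pair _ _ _ (nbhs z)); first exact: chart_continuous iz.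
exact: cX iz.
Qed.

End gateaux_continuity.

(** * Upper semicontinuity of score norms *)

Section upper_semicontinuity.
Context {R : realType} {M : banach_manifold R} {d : measure_display}.
Context {T : measurableType d} {mu : {finite_measure set T -> \bar R}} {k : R}.
Variable S : stat_model M mu k.
Local Notation pbar := (potential S).

(** The threshold comes from the inverse power [k^-1], so continuity of the power on the half-line,
    0 included, reduces to monotonicity. *)
Lemma powR_usc (a e : R) : 0 < k -> 0 <= a -> 0 < e ->
  exists2 b, a < b & forall u, 0 <= u -> u < b -> u `^ k <= a `^ k + e.
Proof.
move=> k0 a0 e0; have ae0 : 0 <= a `^ k + e by rewrite addr_ge0 ?powR_ge0// ltW.
have root u : 0 <= u -> (u `^ k^-1) `^ k = u.
  by move=> u0; rewrite -powRrM mulVf ?gt_eqF// powRr1.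
exists ((a `^ k + e) `^ k^-1).
  rewrite ltNge; apply/negP => /(ge0_ler_powR (ltW k0)).
  rewrite !nnegrE powR_ge0 => /(_ isT a0); rewrite root//.
  by rewrite leNgt ltrDl e0.
move=> u u0 /ltW/(ge0_ler_powR (ltW k0)).
by rewrite !nnegrE powR_ge0 => /(_ u0 isT); rewrite root.
Qed.

Lemma powR_cvg (I : Type) (F : set_system I) (v : I -> R) (a : R) : Filter F ->
  0 < k -> (forall n, 0 <= v n) -> 0 <= a -> v n @[n --> F] --> a ->
  v n `^ k @[n --> F] --> a `^ k.
Proof.
move=> FF k0 v0 a0 va; apply/cvgrPdist_le => e e0.
have [b ab Hb] := powR_usc k0 a0 e0.
have nb : \forall n \near F, v n < b.
  have ba : 0 < b - a by rewrite subr_gt0.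
  move/cvgrPdist_lt : va => /(_ _ ba); apply: filterS => n.
  by rewrite distrC => /(le_lt_trans (ler_norm _)); lra.
have nl : \forall n \near F, a `^ k - e <= v n `^ k.
  have [ae|ae] := leP (a `^ k - e) 0.
    by apply: nearW => n; rewrite (le_trans ae)// powR_ge0.
  pose l := (a `^ k - e) `^ k^-1.
  have lk : l `^ k = a `^ k - e by rewrite -powRrM mulVf ?gt_eqF// powRr1// ltW.
  have la : 0 < a - l.
    rewrite subr_gt0 ltNge; apply/negP => /(ge0_ler_powR (ltW k0)).
    by rewrite !nnegrE powR_ge0 lk => /(_ a0 isT); lra.
  move/cvgrPdist_lt : va => /(_ _ la); apply: filterS => n.
  move=> /(le_lt_trans (ler_norm _)) H.
  rewrite -lk; apply: ge0_ler_powR; rewrite ?nnegrE ?powR_ge0//; first exact: ltW.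
  by lra.
apply: filterS2 nb nl => n /(Hb _ (v0 n)) H1 H2.
by rewrite ler_norml; apply/andP; split; lra.
Qed.

(* Generalized dominated convergence: score^2 <= 1 + |score|^k, and the
   integral of the right-hand side is continuous. *)
Lemma score_usc_ge2 : 2 <= k -> score_usc S.
Proof.
move=> k2 X cX c cc e e0; apply: contrapT => nnear.
have k0 : 0 < k by rewrite (lt_le_trans _ k2).
have [_ aep sc] := potentialP S; have [LX NX] := sc X cX.
pose phi z w := model_score S (X z) w.
have mphi z : measurable_fun setT (phi z) by exact: measurable_model_score.
pose N z : R := fine ('N[S z]_(k%:E)[EFin \o score pbar (X z)])%E.
have N0 z : 0 <= N z by rewrite fine_ge0// Lnorm_ge0.
have normE z : (\int[S z]_w (`|phi z w| `^ k)%:E = (N z `^ k)%:E)%E.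
  have fN : ((N z)%:E = 'N[S z]_(k%:E)[EFin \o score pbar (X z)])%E.
    rewrite fineK// ge0_fin_numE ?Lnorm_ge0//.
    by have /sub_Lfun_finLfun := LX z; rewrite inE.
  rewrite -poweR_EFin fN poweR_Lnorm ?gt_eqF//.
pose a z w := phi z w ^+ 2 * `|pbar z w|.
pose b z w := (1 + `|phi z w| `^ k) * `|pbar z w|.
have mp z : measurable_fun setT (fun w => `|pbar z w|).
  by apply: measurableT_comp => //; exact: measurable_potential.
have mpow z : measurable_fun setT (fun w => `|phi z w| `^ k).
  apply: (measurableT_comp (measurable_powR k)).
  by apply: measurableT_comp => //; exact: mphi.
have ma z : measurable_fun setT (a z).
  by apply: measurable_funM => //; apply: measurable_funX.
have mb z : measurable_fun setT (b z).
  by apply: measurable_funM => //; apply: measurable_funD.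
have ab z w : a z w <= b z w.
  rewrite /a /b ler_wpM2r// -real_normK ?num_real//.
  have [p1|p1] := leP `|phi z w| 1.
    by rewrite (@le_trans _ _ 1) ?lerDl ?powR_ge0// exprn_ile1.
  rewrite (@le_trans _ _ (`|phi z w| `^ k)) ?lerDr// -powR_mulrn//.
  by rewrite ler_powR// ltW.
have aE z : (\int[mu]_w (a z w)%:E = score_sqr S (X z))%E.
  rewrite /score_sqr integral_model//; last 2 first.
  - by apply/measurable_EFinP/measurable_funX; exact: mphi.
  - by move=> w; rewrite lee_fin sqr_ge0.
have bE z : (\int[mu]_w (b z w)%:E = (1 + N z `^ k)%:E)%E.
  transitivity (\int[S z]_w (1%:E + (`|phi z w| `^ k)%:E))%E.
    rewrite integral_model//; last by move=> w; rewrite -EFinD lee_fin addr_ge0 ?powR_ge0.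
    by apply: emeasurable_funD => //; exact/measurable_EFinP.
  rewrite ge0_integralD//; last exact/measurable_EFinP.
  by rewrite integral_cst// mul1e normE EFinD; congr (_ + _)%E; exact: probability_setT.
(* Fatou makes the integral of this non-negative gap lower semicontinuous; as the integral of [b] is
   continuous, that of [a] is upper semicontinuous. *)
pose f z w := b z w - a z w.
have f0 z w : 0 <= f z w by rewrite subr_ge0.
have a0 z w : 0 <= a z w by rewrite mulr_ge0// sqr_ge0.
have fE z : (\int[mu]_w (f z w)%:E + score_sqr S (X z) = (1 + N z `^ k)%:E)%E.
  rewrite -aE -bE -ge0_integralD//.
  - by apply: eq_integral => w _; rewrite -EFinD subrK.
  - by move=> w _; rewrite lee_fin.
  - by apply/measurable_EFinP; exact: measurable_funB.
  - by move=> w _; rewrite lee_fin.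
  - exact/measurable_EFinP.
have e20 : 0 < e / 2 by rewrite divr_gt0.
have [m Nm Hm] := powR_usc k0 (N0 (c 0)) e20.
have Nc : N (c s) @[s --> (0 : R)] --> N (c 0).
  exact: (@continuous_comp _ _ _ c N) cc (NX (c 0)).
have nN : \forall s \near (0 : R), N (c s) < m.
  have mN : 0 < m - N (c 0) by rewrite subr_gt0.
  move/cvgrPdist_lt : Nc => /(_ _ mN); apply: filterS => s.
  by rewrite distrC => /(le_lt_trans (ler_norm _)); lra.
have ex n : exists s : R, [/\ `|s| < n.+1%:R^-1, N (c s) < m &
    ~ (score_sqr S (X (c s)) <= (fisher S (X (c 0)) (X (c 0)) + e)%:E)%E].
  apply: contrapT => nex; apply: nnear.
  have n0 : 0 < n.+1%:R^-1 :> R by rewrite invr_gt0.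
  have nb : \forall s \near (0 : R), `|s| < n.+1%:R^-1.
    have := @nbhsx_ballx _ R^o 0 _ n0; apply: filterS => s.
    by rewrite -ball_normE/= sub0r normrN.
  apply: filterS2 nN nb => s Ns sn; apply: contrapT => ns.
  by apply: nex; exists s.
have [s Hs] := choice ex.
have s0 : s n @[n --> \oo] --> (0 : R).
  apply/cvgrPdist_lt => q q0; have := @cvg_harmonic R.
  move/cvgrPdist_lt => /(_ _ q0); apply: filterS => n.
  rewrite !sub0r !normrN => /(le_lt_trans (ler_norm _)) /= qn.
  by have [sn _ _] := Hs n; exact: lt_trans sn qn.
have cs : c (s n) @[n --> \oo] --> c 0.
  exact: (@cvg_comp _ _ _ s c) s0 cc.
set F := fisher S (X (c 0)) (X (c 0)) in Hs.
(* Half of the margin [e] pays for the variation of [N]; the other half will contradict [fE] at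
   [c 0]. *)
have bnd n : (\int[mu]_w (f (c (s n)) w)%:E <=
    (1 + N (c 0) `^ k - e / 2 - F)%:E)%E.
  have [_ /(Hm _ (N0 _)) Nn /negP] := Hs n; rewrite -ltNge.
  have := fE (c (s n)); have := score_sqr_ge0 S (X (c (s n))).
  have : (0 <= \int[mu]_w (f (c (s n)) w)%:E)%E.
    by apply: integral_ge0 => w _; rewrite lee_fin.
  case: (integral _ _ _) => [u| |]//; case: (score_sqr _ _) => [v| |]//.
  move=> _ _ /eqP; rewrite -EFinD eqe lte_fin lee_fin => /eqP.
  by move: Nn; clear; set p := _ `^ _; set q := _ `^ _; lra.
have H : (\int[mu]_w (f (c 0) w)%:E <= (1 + N (c 0) `^ k - e / 2 - F)%:E)%E.
  apply: (@ae_fatou_le _ _ _ mu (fun n => f (c (s n)))) => //.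
  - by move=> n; exact: measurable_funB.
  - exact: measurable_funB.
  - apply: filterS aep => w [pw gw].
    have phic : phi (c (s n)) w @[n --> \oo] --> phi (c 0) w.
      apply: (@cvg_comp _ _ _ (c \o s) (fun z => phi z w)) cs _.
      exact: (dirderiv_continuous gw cX).
    have pc : `|pbar (c (s n)) w| @[n --> \oo] --> `|pbar (c 0) w|.
      apply: cvg_norm.
      rewrite -(lnK (pw (c 0))); under eq_fun do rewrite -(lnK (pw (c (s _)))).
      apply: (@cvg_comp _ _ _ (fun n => ln (pbar (c (s n)) w)) expR); last first.
        exact: continuous_expR.
      apply: (@cvg_comp _ _ _ (c \o s) (fun z => ln (pbar z w))) cs _.
      exact: (gateaux_continuous gw).
    apply: cvgB; apply: cvgM => //.
      apply: cvgD; first exact: cvg_cst.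
      by apply: powR_cvg => //; exact: cvg_norm.
    by rewrite expr2; under eq_fun do rewrite expr2; exact: cvgM.
have := fE (c 0); have := score_sqr_ge0 S (X (c 0)).
have : (0 <= \int[mu]_w (f (c 0) w)%:E)%E.
  by apply: integral_ge0 => w _; rewrite lee_fin.
rewrite /F fisher_diag in H *; move: H.
case: (integral _ _ _) => [u| |]//; case: (score_sqr _ _) => [v| |]//=.
rewrite lee_fin => + _ _ /eqP; rewrite -EFinD eqe => + /eqP.
by move: e20; clear; set p := _ `^ _; lra.
Qed.

End upper_semicontinuity.

(** * Finite sample spaces *)

(** Needed because the form [Ft] of a local field takes the bundled measure as argument: a model
    must be shown to pass through a given element of [Pplus], not just through one with the same
    weights. *)
Lemma eq_probability (R : realType) d (T : measurableType d)
    (P Q : probability T R) : (P : set T -> \bar R) = Q -> P = Q.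
Proof.
case: P Q => [p [[p1 p2] [p3] [p4] [p5] [p6] [p7] [p8]]].
case=> [q [[q1 q2] [q3] [q4] [q5] [q6] [q7] [q8]]] /= E; subst q.
by rewrite (Prop_irrelevance q1 p1) (Prop_irrelevance q2 p2)
  (Prop_irrelevance q3 p3) (Prop_irrelevance q4 p4) (Prop_irrelevance q5 p5)
  (Prop_irrelevance q6 p6) (Prop_irrelevance q7 p7) (Prop_irrelevance q8 p8).
Qed.

Section finite_sample.
Context {R : realType} {n : nat}.
Local Notation Om := (fin_sample n).

Lemma fin_measurable (A : set Om) : measurable A.
Proof. by []. Qed.

Lemma fin_measurable_fun d (U : measurableType d) (f : Om -> U) :
  measurable_fun setT f.
Proof. by move=> _ Y _; exact: fin_measurable. Qed.

Lemma fin_fun_indic (f : Om -> R) (w : Om) :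
  f w = \sum_(i < n.+1) f i * \1_[set (i : Om)] w.
Proof.
rewrite (bigD1 (w : 'I_n.+1))//= indicE mem_set// mulr1 big1 ?addr0// => i iw.
by rewrite indicE memNset ?mulr0//= => wi; rewrite -wi eqxx in iw.
Qed.

Lemma fin_indic_integrable (mu : {finite_measure set Om -> \bar R}) (a : R) (i : Om) :
  mu.-integrable setT (fun w => (a * \1_[set i] w)%:E).
Proof.
rewrite (_ : (fun w => _) = (fun w => (a%:E * (\1_[set i] w)%:E)%E)) //.
by apply: integrableZl => //; exact: integrable_indic.
Qed.

Lemma fin_integrable (mu : {finite_measure set Om -> \bar R}) (f : Om -> R) :
  mu.-integrable setT (EFin \o f).
Proof.
rewrite (_ : EFin \o f = fun w => (\sum_(i < n.+1) (f i * \1_[set (i : Om)] w)%:E)%E).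
  by apply: integrable_sum => // i _; exact: fin_indic_integrable.
by apply/funext => w; rewrite sumEFin -fin_fun_indic.
Qed.

Lemma integral_fin (mu : {finite_measure set Om -> \bar R}) (f : Om -> R) :
  (\int[mu]_w (f w)%:E = \sum_(i < n.+1) (f i)%:E * mu [set (i : Om)])%E.
Proof.
transitivity (\int[mu]_w (\sum_(i < n.+1) (f i * \1_[set (i : Om)] w)%:E))%E.
  by apply: eq_integral => w _; rewrite sumEFin -fin_fun_indic.
rewrite integral_sum//; last by move=> i; exact: fin_indic_integrable.
apply: eq_bigr => i _; under eq_integral do rewrite EFinM.
by rewrite integralZl//; [rewrite integral_indic// setIT|exact: integrable_indic].
Qed.

Lemma integral_fin_restrict (mu : {finite_measure set Om -> \bar R})
    (A : set Om) (f : Om -> R) :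
  (\int[mu]_(w in A) (f w)%:E =
   \sum_(i < n.+1) (f i * \1_A (i : Om))%:E * mu [set (i : Om)])%E.
Proof.
rewrite integral_mkcond -(integral_fin mu (fun w => f w * \1_A w)).
by apply: eq_integral => w _; rewrite patchE indicE; case: (w \in A);
  rewrite ?mulr1// mulr0.
Qed.

Definition pweight (P : {finite_measure set Om -> \bar R}) (i : Om) : R :=
  fine (P [set i]).

Lemma pweightE (P : {finite_measure set Om -> \bar R}) (i : Om) :
  P [set i] = (pweight P i)%:E.
Proof. by rewrite fineK// fin_num_measure. Qed.

Lemma measure_fin (P : {finite_measure set Om -> \bar R}) (A : set Om) :
  P A = (\sum_(i < n.+1) pweight P i * \1_A (i : Om))%:E.
Proof.
transitivity (\int[P]_w (\1_A w)%:E)%E; first by rewrite integral_indic// setIT.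
rewrite integral_fin -sumEFin; apply: eq_bigr => i _.
by rewrite pweightE mulrC.
Qed.

Lemma Rintegral_fin (P : {finite_measure set Om -> \bar R}) (f : Om -> R) :
  \int[P]_w f w = \sum_(i < n.+1) pweight P i * f i.
Proof.
rewrite /Rintegral integral_fin.
under eq_bigr do rewrite pweightE -EFinM.
by rewrite sumEFin; apply: eq_bigr => i _; rewrite mulrC.
Qed.

Lemma pweight_sum (P : probability Om R) : \sum_(i < n.+1) pweight P i = 1.
Proof.
have [->] := etrans (esym (probability_setT P)) (measure_fin P setT).
by apply: eq_bigr => i _; rewrite indicT mulr1.
Qed.

Lemma unif_set1 (i : Om) : unif R n [set i] = (n.+1%:R^-1)%:E.
Proof.
rewrite /unif /mscale /= /counting asboolT; last exact: finite_set1.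
by rewrite fset_set1 finmap.cardfs1 mule1.
Qed.

Lemma pweight_unif (i : Om) : pweight (unif R n) i = n.+1%:R^-1.
Proof. by rewrite (congr1 fine (unif_set1 i) : pweight (unif R n) i = _). Qed.

(** Every atom has positive mass, so null sets are empty. *)
Lemma ae_unif (Q : Om -> Prop) : {ae unif R n, forall w, Q w} -> forall w, Q w.
Proof.
move=> [N [_ N0 QN]] w; apply: contrapT => nQ.
have : (unif R n [set w] <= unif R n N)%E.
  by apply: le_measure; rewrite ?inE//; move=> _ ->; exact: QN.
by rewrite N0 unif_set1 lee_fin leNgt invr_gt0 ltr0n.
Qed.

Lemma is_density_fin (phi : Om -> R) (P : probability Om R) :
  is_density (unif R n) phi P -> forall w, phi w = n.+1%:R * pweight P w.
Proof.
move=> [_ _ PE] w.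
have := PE [set w] (fin_measurable _).
rewrite integral_fin_restrict (bigD1 (w : 'I_n.+1))//= big1 ?adde0; last first.
  move=> i iw; rewrite indicE memNset ?mulr0 ?mul0e//= => wi.
  by rewrite -wi eqxx in iw.
rewrite indicE mem_set// mulr1 !pweightE -EFinM pweight_unif => -[->].
by rewrite mulrC divfK// pnatr_eq0.
Qed.

Lemma pweight_gt0 (P : Pplus (unif R n)) w : 0 < pweight P w.
Proof.
have [phi dphi] := Pplus_dominated P.
have [_ /ae_unif/(_ w) + _] := dphi.
by rewrite (is_density_fin dphi) pmulr_rgt0.
Qed.

Lemma Pplus_eq (P Q : Pplus (unif R n)) :
  (forall w, pweight P w = pweight Q w) -> P = Q.
Proof.
move=> PQ; have : (P : probability Om R) = Q.
  apply: eq_probability; apply/funext => A; rewrite !measure_fin.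
  by under eq_bigr do rewrite PQ.
case: P Q {PQ} => [P dP] [Q dQ] /= E; rewrite E in dP *.
by congr MkPplus; exact: Prop_irrelevance.
Qed.

End finite_sample.

Section finite_models.
Context {R : realType} {M : banach_manifold R} {n : nat} {k : R}.
Variable S : stat_model M (unif R n) k.
Local Notation Om := (fin_sample n).

Definition mweight (x : M) (w : Om) : R := pweight (S x) w.

Lemma potential_fin (x : M) (w : Om) : potential S x w = n.+1%:R * mweight x w.
Proof. by have [/(_ x)/is_density_fin -> _ _] := potentialP S. Qed.

Lemma mweight_gt0 (x : M) w : 0 < mweight x w.
Proof. exact: pweight_gt0. Qed.

Lemma mweight_sum (x : M) : \sum_(i < n.+1) mweight x i = 1.
Proof. exact: pweight_sum. Qed.

Lemma potential_fin_gateaux (w : Om) :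
  continuously_gateaux (fun x : M => ln (potential S x w)).
Proof. by have [_ /ae_unif/(_ w)[] _ + _] := potentialP S. Qed.

Lemma model_score_linear (x : M) (w : Om) :
  scalar (fun V : tangent x => model_score S V w).
Proof. exact: (dirderiv_linear (potential_fin_gateaux w)). Qed.

Lemma model_score_continuous (w : Om) (X : forall x : M, tangent x) :
  continuous_vfield X -> continuous (fun x => model_score S (X x) w).
Proof. exact: (dirderiv_continuous (potential_fin_gateaux w)). Qed.

Lemma mweight_continuous (w : Om) : continuous (mweight ^~ w).
Proof.
move=> x; have -> : mweight ^~ w =
    (fun y => n.+1%:R^-1 * expR (ln (potential S y w))).
  apply/funext => y; rewrite lnK ?potential_fin ?mulKf ?pnatr_eq0//.
  by rewrite posrE mulr_gt0// mweight_gt0.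
apply: cvgMl_tmp; apply: continuous_comp; last exact: continuous_expR.
exact: (gateaux_continuous (potential_fin_gateaux w)).
Qed.

Lemma fisher_fin (x : M) (V W : tangent x) :
  fisher S V W =
  \sum_(i < n.+1) mweight x i * (model_score S V i * model_score S W i).
Proof. exact: Rintegral_fin. Qed.

Lemma fisher_fin_continuous (V W : forall x : M, tangent x) :
  continuous_vfield V -> continuous_vfield W ->
  continuous (fun x => fisher S (V x) (W x)).
Proof.
move=> cV cW x; under eq_fun do rewrite fisher_fin.
apply: (@cvg_big _ _ _ _ _ add_continuous) => i _; apply: cvgM; first exact: mweight_continuous.
by apply: cvgM; exact: model_score_continuous.
Qed.

(** Weights and scores are continuous at each atom, so the Fisher sum is continuous, whatever the
    exponent [k]. *)
Lemma score_usc_fin : score_usc S.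
Proof.
move=> X cX c cc e e0.
have fE z : score_sqr S (X z) = (fisher S (X z) (X z))%:E.
  rewrite fisher_diag fineK// /score_sqr integral_fin.
  by apply/sum_fin_numP => i _ _; rewrite pweightE.
have fc : fisher S (X (c s)) (X (c s)) @[s --> (0 : R)] -->
    fisher S (X (c 0)) (X (c 0)).
  apply: (@cvg_comp _ _ _ c (fun z => fisher S (X z) (X z))) cc _.
  exact: (fisher_fin_continuous cX cX).
move/cvgrPdist_lt : fc => /(_ _ e0); apply: filterS => s.
by rewrite distrC fE lee_fin => /(le_lt_trans (ler_norm _)); lra.
Qed.

(** Differentiate the constant total mass along a chart line. Weight times score is therefore
    tangent to the simplex. *)
Lemma model_score_mean (x : M) (V : tangent x) :
  \sum_(i < n.+1) mweight x i * model_score S V i = 0.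
Proof.
have D i : is_derive (0 : R) 1 (fun s => potential S (chart_line V s) (i : 'I_n.+1))
    (potential S x i * model_score S V i).
  have gi := potential_fin_gateaux i.
  have [dg _ _] := gi (chart_at (bm_atlas M) x).
  have Dl : is_derive (0 : R) 1 (fun s => ln (potential S (chart_line V s) i))
      (model_score S V i).
    apply: (@is_derive_line _ _ _ ((fun y => ln (potential S y i)) \o
      chart_inv (bm_atlas M) _) (chart (bm_atlas M) (chart_at (bm_atlas M) x) x) V
      0 _).2.
    rewrite scale0r addr0; apply/derivableP/dg.
    by exists x => //; exact: chart_atP.
  have p0 y : 0 < potential S y i by rewrite potential_fin mulr_gt0// mweight_gt0.
  have := @is_derive1_comp _ expR _ 0 _ _ (is_derive_expR _) Dl.
  rewrite /= lnK ?chart_line0; last exact: p0.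
  congr (is_derive _ _ _ _); apply/funext => s /=.
  by rewrite lnK//; exact: p0.
have [_ Dsum] := is_derive_sum D.
have cE : \sum_(i < n.+1) (fun s => potential S (chart_line V s) i) =
    cst (n.+1%:R : R).
  apply/funext => s; rewrite fct_sumE.
  under eq_bigr do rewrite potential_fin.
  by rewrite -mulr_sumr mweight_sum mulr1.
rewrite cE derive_cst in Dsum.
have n0 : n.+1%:R != 0 :> R by rewrite pnatr_eq0.
apply: (mulfI n0); rewrite mulr0 [RHS]Dsum mulr_sumr.
by apply: eq_bigr => i _; rewrite potential_fin mulrA.
Qed.

End finite_models.

Section fisher_field.
Context {R : realType} {k : R}.

Lemma fisher_field_symmetric_bilinear :
  symmetric_bilinear_field (@fisher_field R k).
Proof.
move=> M n S x; split; last first.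
  by move=> V W; rewrite /fisher_field !fisher_fin;
    apply: eq_bigr => i _; rewrite [X in _ * X]mulrC.
split=> W a U V /=; rewrite /fisher_field !fisher_fin mulr_sumr -big_split/=;
    apply: eq_bigr => i _; rewrite model_score_linear/=.
  by rewrite mulrDl mulrDr -mulrA mulrCA.
move: (mweight S x i) (model_score S U i) (model_score S V i) (model_score S W i).
by move=> w u v z; ring.
Qed.

Lemma fisher_field_local : local_field (@fisher_field R k).
Proof.
exists (fun n nu u v => \sum_(i < n.+1) pweight nu i * (u i * v i)).
split=> [n nu|M n S x V W]; last exact: fisher_fin.
split=> w a u v /=; rewrite mulr_sumr -big_split/=;
    apply: eq_bigr => i _; rewrite -[(a *: u + v) i]/(a * u i + v i); ring.
Qed.

Lemma fisher_field_weakly_continuous :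
  weakly_continuous_field (@fisher_field R k).
Proof. by move=> M n S V W cV cW; exact: fisher_fin_continuous. Qed.

Lemma fisher_field_monotone : monotone_field (@fisher_field R k).
Proof.
by move=> M n1 n2 S1 S2 f K fK x V; apply: fisher_monotone fK; exact: score_usc_fin.
Qed.

End fisher_field.

(** * Banach spaces as manifolds with one chart *)

Section vector_space_manifold.
Context {R : realType} (E : completeNormedModType R).

Lemma Cn_on_id (n : nat) (U : set E) : Cn_on n U (@id E).
Proof.
exists (fun x s => match s with [::] => x | [:: h] => h | _ => 0 end).
have z m (v : m.-tuple E) : 0 <= \prod_(e <- v) `|e| by apply: prodr_ge0.
split=> //.
- move=> x _ s t _; case: s => [|a [|b s]]; case: t => [|c t] //= h u v;
    by rewrite scaler0 addr0.
- move=> x _ [|[|m]] _.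
  + by exists `|x| => v; rewrite tuple0 big_nil mulr1.
  + by exists 1 => v; case/tupleP: v => a v; rewrite tuple0 /= big_seq1 mul1r.
  + exists 0 => v; case/tupleP: v => a v; case/tupleP: v => b v.
    by rewrite /= normr0 mul0r.
- move=> x _ m _ e e0; apply: nearW => y v.
  rewrite [X in `|X|](_ : _ = 0); last first.
    by case: v => -[|a [|b v]] _ /=; rewrite ?subrr// subr0.
  by rewrite normr0 mulr_ge0// mulr_ge0// ltW.
- move=> x _ e e0.
  have nb : \forall y \near x, `|y - x| <= e.
    apply/nbhs_ballP; exists e => // y; rewrite -ball_normE/= distrC => /ltW.
    by [].
  apply: filterS nb => y yx v.
  case: n v => [|n] v; first by rewrite tuple0 big_nil mulr1.
  rewrite [X in `|X|](_ : _ = 0); last first.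
    by case/tupleP: v => a v; case: v => -[|b v] _ /=; rewrite subrr.
  by rewrite normr0 mulr_ge0// ltW.
Qed.

Definition vspace_atlas : atlas E (fun _ : unit => E).
Proof.
refine (@Atlas R E unit (fun _ => E) (fun _ => setT) (fun _ => id) (fun _ => id)
  (fun _ => tt) _ _ _ _ _ _ _) => //.
- by move=> _; exact: openT.
- by move=> _; rewrite image_id; exact: openT.
- by move=> _ x _; exact: cvg_id.
- by move=> _ x _; exact: cvg_id.
- by move=> i j n; exact: Cn_on_id.
Defined.

Definition vspace_manifold : banach_manifold R :=
  @BanachManifold R E unit (fun _ => E) vspace_atlas
    (@norm_hausdorff R E) (@uniform_regular E).

Lemma vspace_id_diffeomorphism : diffeomorphism (@id vspace_manifold).
Proof.
have C1 : C1_map (@id vspace_manifold).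
  by split=> [x|i j]; [exact: cvg_id|exact: Cn_on_id].
by split=> //; exists id.
Qed.

Lemma vspace_tangent_map_id (x : vspace_manifold) (V : tangent x) :
  tangent_map (@id vspace_manifold) V = V.
Proof. by rewrite /tangent_map (@diff_val _ _ _ _ _ _ _ (is_diff_id _)). Qed.

Lemma vspace_continuous_vfield (X : E -> E) :
  continuous X -> @continuous_vfield R vspace_manifold X.
Proof.
move=> cX i x _.
rewrite (_ : (fun y => _) = X); first exact: cX.
apply/funext => y.
by rewrite /tangent_coord (@diff_val _ _ _ _ _ _ _ (is_diff_id _)).
Qed.

Lemma vspace_gateaux (g : E -> R) (dg : E -> E -> R) :
  (forall x v, is_derive x v g (dg x v)) ->
  (forall x, scalar (dg x)) ->
  (forall z : E * E, {for z, continuous (fun z : E * E => dg z.1 z.2)}) ->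
  @continuously_gateaux R vspace_manifold g.
Proof.
move=> gd ld cd i.
have dE x v : 'D_v g x = dg x v by case: (gd x v).
split=> /=.
- by move=> x v _; case: (gd x v).
- by move=> x _ a u v /=; rewrite !dE ld.
- move=> x v _; rewrite (_ : (fun z : E * E => _) = (fun z => dg z.1 z.2)).
    exact: cd.
  by apply/funext => z; rewrite dE.
Qed.

Lemma vspace_model_score d (T : measurableType d) (mu : {finite_measure set T -> \bar R})
   (k : R) (S : stat_model vspace_manifold mu k) (x : vspace_manifold)
   (V : tangent x) (w : T) :
  model_score S V w = 'D_(V : E) (fun y : E => ln (potential S y w)) x.
Proof. by []. Qed.

End vector_space_manifold.

(** * Realizing prescribed weights and stochastic matrices *)

Section finite_probability.
Context {R : realType} {m : nat}.
Local Notation Om := (fin_sample m).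
Variable q : Om -> R.
Hypothesis q0 : forall w, 0 < q w.
Hypothesis q1 : \sum_(i < m.+1) q i = 1.

(** [inord] bridges the [nat] indices of [msum]; the absolute value supplies the non-negative scalar
    that [mscale] takes and disappears by [q0]. *)
Definition weight_measure : set Om -> \bar R :=
  msum (fun i : nat => mscale (`|q (inord i : 'I_m.+1)|%:nng)
    (\d_((inord i : 'I_m.+1) : Om))) m.+1.

HB.instance Definition _ := Measure.on weight_measure.

Lemma weight_measureE (A : set Om) :
  weight_measure A = (\sum_(i < m.+1) q i * \1_A (i : Om))%:E.
Proof.
rewrite /weight_measure /msum /mscale -sumEFin; apply: eq_bigr => i _ /=.
by rewrite /mscale/= diracE indicE inord_val EFinM (gtr0_norm (q0 _)).
Qed.

Lemma weight_measure_setT : weight_measure setT = 1%E.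
Proof.
rewrite weight_measureE; congr (_%:E); rewrite -[RHS]q1.
by apply: eq_bigr => i _; rewrite indicT mulr1.
Qed.

HB.instance Definition _ :=
  Measure_isProbability.Build _ _ _ weight_measure weight_measure_setT.

Lemma exists_fin_probability : exists P : probability Om R,
  forall w, pweight P w = q w.
Proof.
exists weight_measure => w.
rewrite /pweight /= weight_measureE /= (bigD1 (w : 'I_m.+1))//= indicE mem_set//.
rewrite mulr1 big1 ?addr0// => i iw.
by rewrite indicE memNset ?mulr0//= => wi; rewrite -wi eqxx in iw.
Qed.

End finite_probability.

Section finite_constructions.
Context {R : realType}.

Lemma is_density_weight m (P : probability (fin_sample m) R) :
  (forall w, 0 < pweight P w) ->
  is_density (unif R m) (fun w => m.+1%:R * pweight P w) P.
Proof.
move=> p0; split.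
- exact: fin_integrable.
- by apply: nearW => w; rewrite mulr_gt0.
- move=> A mA; rewrite integral_fin_restrict measure_fin -sumEFin.
  apply: eq_bigr => i _; rewrite pweightE pweight_unif -EFinM; congr (_%:E).
  by rewrite -[X in X / _]mulrA mulrAC divff ?mul1r// pnatr_eq0.
Qed.

Lemma exists_Pplus m (q : fin_sample m -> R) :
  (forall w, 0 < q w) -> \sum_(i < m.+1) q i = 1 ->
  exists P : Pplus (unif R m), forall w, pweight P w = q w.
Proof.
move=> q0 q1; have [P Pq] := exists_fin_probability q0 q1.
have P0 w : 0 < pweight P w by rewrite Pq.
by exists (MkPplus (ex_intro (fun phi => is_density (unif R m) phi P) _
  (is_density_weight P0))).
Qed.

(** On a finite sample space integrability is automatic, and continuity of [p] and of the $L^k$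
    norms reduces to finite sums of continuous functions. *)
Lemma exists_fin_model (M : banach_manifold R) m (k : R)
    (q : M -> fin_sample m -> R) : 1 <= k ->
  (forall x w, 0 < q x w) -> (forall x, \sum_(i < m.+1) q x i = 1) ->
  (forall w, continuously_gateaux (fun x => ln (m.+1%:R * q x w))) ->
  exists S : stat_model M (unif R m) k, forall x w, mweight S x w = q x w.
Proof.
move=> k1 q0 q1 gq.
have k0 : 0 < k by rewrite (lt_le_trans _ k1).
have [p pq] := choice (fun x => exists_Pplus (q0 x) (q1 x)).
have qc w : continuous (q ^~ w).
  move=> x; have -> : q ^~ w = (fun y => m.+1%:R^-1 * expR (ln (m.+1%:R * q y w))).
    apply/funext => y; rewrite lnK ?mulKf ?pnatr_eq0//.
    by rewrite posrE mulr_gt0.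
  apply: cvgMl_tmp; apply: continuous_comp; last exact: continuous_expR.
  exact: (gateaux_continuous (gq w)).
have dp x w : density (p x) w = m.+1%:R * q x w.
  rewrite -pq; exact: (is_density_fin (svalP (cid (Pplus_dominated (p x))))).
have pc : L1_continuous p.
  move=> x; rewrite (_ : (fun y => _) =
      fun y => \sum_(i < m.+1) m.+1%:R^-1 * `|m.+1%:R * q y i - m.+1%:R * q x i|); last first.
    apply/funext => y; rewrite Rintegral_fin; apply: eq_bigr => i _.
    by rewrite pweight_unif !dp.
  rewrite [X in _ --> X](_ : _ = \sum_(i < m.+1) m.+1%:R^-1 *
      `|m.+1%:R * q x i - m.+1%:R * q x i|); last first.
    by rewrite big1// => i _; rewrite subrr normr0 mulr0.
  apply: (@cvg_big _ _ _ _ _ add_continuous) => i _.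
  apply: cvgMl_tmp; apply: cvg_norm; apply: cvgB; last exact: cvg_cst.
  by apply: cvgMl_tmp; exact: qc.
pose pbar x w := m.+1%:R * q x w.
suff pot : density_potential k p pbar.
  exists (StatModel pc (ex_intro (density_potential k p) pbar pot)) => x w.
  by rewrite /mweight pq.
split=> [x|  |V cV].
- have := @is_density_weight m (p x).
  rewrite (_ : (fun w => _) = pbar x); last by apply/funext => w; rewrite pq.
  by apply=> w; rewrite pq.
- apply: nearW => w; split=> [x|]; first by rewrite mulr_gt0.
  exact: gq.
- have sc w : continuous (fun x => score pbar (V x) w).
    exact: (@dirderiv_continuous _ _ _ (gq w) V cV).
  have NE x : ('N[p x]_(k%:E)[EFin \o score pbar (V x)] =
      ((\sum_(i < m.+1) q x i * `|score pbar (V x) i| `^ k) `^ k^-1)%:E)%E.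
    rewrite -poweR_EFin; apply/esym.
    rewrite (_ : (\sum_(i < m.+1) q x i * `|score pbar (V x) i| `^ k)%:E =
      \int[p x]_w (`|score pbar (V x) w| `^ k)%:E)%E; last first.
      rewrite integral_fin -sumEFin; apply: eq_bigr => i _.
      by rewrite pweightE pq mulrC.
    by rewrite unlock.
  split=> [x|].
    apply/andP; split; rewrite inE; first exact: fin_measurable_fun.
    by rewrite /= /finite_norm NE ltry.
  under eq_fun do rewrite NE /=.
  move=> x; apply: powR_cvg.
  + by rewrite invr_gt0.
  + by move=> y; apply: sumr_ge0 => i _; rewrite mulr_ge0 ?powR_ge0// ltW.
  + by apply: sumr_ge0 => i _; rewrite mulr_ge0 ?powR_ge0// ltW.
  apply: (@cvg_big _ _ _ _ _ add_continuous) => i _; apply: cvgM; first exact: qc.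
  apply: powR_cvg => //; apply: cvg_norm; exact: sc.
Qed.

End finite_constructions.

Section finite_kernels.
Context {R : realType}.

Lemma exists_fin_representable (M : banach_manifold R) (k : R) (n1 n2 : nat)
    (S1 : stat_model M (unif R n1) k) (S2 : stat_model M (unif R n2) k)
    (K : fin_sample n1 -> fin_sample n2 -> R) :
  diffeomorphism (@id M) ->
  (forall i j, 0 < K i j) -> (forall i, \sum_(j < n2.+1) K i j = 1) ->
  (forall x j, mweight S2 x j = \sum_(i < n1.+1) mweight S1 x i * K i j) ->
  exists kappa : R.-pker fin_sample n1 ~> fin_sample n2,
    representable_morphism S1 S2 id kappa.
Proof.
move=> did K0 K1 S12.
have [P PK] := choice (fun i => exists_fin_probability (K0 i) (K1 i)).
have mP : measurable_fun setT (fun i => P i : pprobability (fin_sample n2) R).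
  exact: fin_measurable_fun.
pose kappa : R.-pker fin_sample n1 ~> fin_sample n2 := kprobability mP.
have kE i A : kappa i A = (\sum_(j < n2.+1) K i j * \1_A (j : fin_sample n2))%:E.
  rewrite -[LHS]/(P i A) measure_fin.
  by under eq_bigr do rewrite PK.
exists kappa; split => //.
- split; first by case: did.
  move=> x A mA; rewrite /markov_push measure_fin.
  under eq_integral do rewrite kE.
  rewrite integral_fin.
  under [RHS]eq_bigr do rewrite pweightE -EFinM.
  rewrite sumEFin; congr (_%:E).
  under eq_bigr do rewrite -/(mweight S2 x _) S12 mulr_suml.
  rewrite exchange_big/=; apply: eq_bigr => i _; rewrite mulr_suml.
  by apply: eq_bigr => j _; rewrite [RHS]mulrC mulrA.
(* The factor turns the rows of the matrix into densities with respect to the uniform measure, whose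
   atoms have mass [n2.+1%:R^-1]. *)
- exists (fun z => n2.+1%:R * K z.1 z.2); split; last first.
    move=> nu A mA; apply: eq_integral => i _; rewrite -[LHS]/(kappa i A) kE.
    rewrite integral_fin_restrict -sumEFin; apply: eq_bigr => j _ /=.
    rewrite pweightE pweight_unif -EFinM; congr (_%:E).
    by rewrite -[X in X / _]mulrA mulrAC divff ?mul1r// pnatr_eq0.
  split=> [|z|i]; last 2 first.
  + by rewrite mulr_gt0.
  + transitivity (\sum_(j < n2.+1) K i j)%:E; last by rewrite K1.
    rewrite integral_fin -sumEFin; apply: eq_bigr => j _ /=.
    rewrite pweightE pweight_unif -EFinM; congr (_%:E).
    by rewrite mulrAC divff ?mul1r// pnatr_eq0.
  (* Measurability refers to the product sigma-algebra, so the matrix is expanded in products of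
     indicators of the two factors. *)
  rewrite (_ : (fun z => _) = fun z => n2.+1%:R * (\sum_(i < n1.+1)
     (\sum_(j < n2.+1) K i j * \1_[set (j : fin_sample n2)] z.2) *
     \1_[set (i : fin_sample n1)] z.1)); last first.
    apply/funext => -[a b] /=; congr (_ * _).
    rewrite (fin_fun_indic (K^~ b) a); apply: eq_bigr => i _.
    by rewrite (fin_fun_indic (K i) b).
  apply: measurable_funM => //; apply: measurable_sum => i.
  apply: measurable_funM; last first.
    by apply: measurableT_comp => //; exact: fin_measurable_fun.
  apply: measurable_sum => j; apply: measurable_funM => //.
  by apply: measurableT_comp => //; exact: fin_measurable_fun.
Qed.

End finite_kernels.

Lemma cvg_sumr (R : realType) (I T : Type) (F : set_system T) (r : seq I)
    (f : I -> T -> R) (l : I -> R) : Filter F ->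
  (forall i, f i y @[y --> F] --> l i) ->
  (\sum_(i <- r) f i y) @[y --> F] --> \sum_(i <- r) l i.
Proof. by move=> FF fl; apply: (@cvg_big _ _ _ _ _ add_continuous). Qed.

(** * Softmax families and their images under kernels *)

Section softmax.
Context {R : realType} {n : nat}.
Local Notation E := 'rV[R]_n.+1.

(** For [c] constantly 1 this is the softmax normalizer; for [c] a column of a kernel it is an image
    weight before normalization. *)
Definition expsum (c : 'I_n.+1 -> R) (x : E) : R :=
  \sum_(i < n.+1) c i * expR (x ord0 i).

Definition dexpsum (c : 'I_n.+1 -> R) (x v : E) : R :=
  \sum_(i < n.+1) c i * expR (x ord0 i) * v ord0 i.

Lemma is_derive_expsum c (x v : E) : is_derive x v (expsum c) (dexpsum c x v).
Proof.
have H : is_derive (0 : R) 1 (\sum_(i < n.+1)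
    (fun s : R => c i * expR (x ord0 i + s * v ord0 i))) (dexpsum c x v).
  apply: is_derive_sum => i.
  have D : is_derive (0 : R) 1 (fun s : R => x ord0 i + s * v ord0 i) (v ord0 i).
    have := is_deriveD (is_derive_cst (x ord0 i) (0 : R) 1)
      (is_deriveZ (v ord0 i) (is_derive_id (0 : R) (1 : R))).
    rewrite add0r [_ *: 1]mulr1; congr (is_derive _ _ _ _).
    by apply/funext => s; rewrite !fctE/= [_ *: _]mulrC.
  have := @is_derive1_comp _ expR _ 0 _ _ (is_derive_expR _) D.
  rewrite mul0r addr0 => D2; rewrite -mulrA; exact: is_deriveZ.
have := is_derive_line (expsum c) x v 0 (dexpsum c x v).
rewrite scale0r addr0 => -[+ _]; apply.
move: H; congr (is_derive _ _ _ _); apply/funext => s.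
by rewrite fct_sumE; apply: eq_bigr => i _; rewrite !mxE.
Qed.

Lemma expsum_gt0 c (x : E) : (forall i, 0 <= c i) -> (exists i, 0 < c i) ->
  0 < expsum c x.
Proof.
move=> c0 [i ci]; rewrite /expsum (bigD1 i)//= ltr_pwDl//.
  by rewrite mulr_gt0// expR_gt0.
by apply: sumr_ge0 => j _; rewrite mulr_ge0// expR_ge0.
Qed.

Lemma is_derive_ln_expsum c (x v : E) : (forall i, 0 <= c i) ->
  (exists i, 0 < c i) ->
  is_derive x v (fun x => ln (expsum c x)) (dexpsum c x v / expsum c x).
Proof.
move=> c0 c1.
have := is_derive_line (fun x => ln (expsum c x)) x v 0 (dexpsum c x v / expsum c x).
rewrite scale0r addr0 => -[+ _]; apply.
have D : is_derive (0 : R) 1 (fun s : R => expsum c (x + s *: v)) (dexpsum c x v).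
  apply/is_derive_line; rewrite scale0r addr0; exact: is_derive_expsum.
have Z0 : 0 < expsum c (x + 0 *: v) by exact: expsum_gt0.
have := @is_derive1_comp _ (@ln R) _ 0 _ _ (is_derive1_ln Z0) D.
by rewrite scale0r addr0 mulrC.
Qed.

Lemma dexpsum_linear c x : scalar (dexpsum c x).
Proof.
move=> a u v; rewrite /dexpsum mulr_sumr -big_split/=.
by apply: eq_bigr => i _; rewrite !mxE; ring.
Qed.

Lemma coord_expR_cvg i : continuous (fun x : E => expR (x ord0 i)).
Proof.
move=> x; apply: continuous_comp; last exact: continuous_expR.
exact: coord_continuous.
Qed.

Lemma expsum_continuous c : continuous (expsum c).
Proof.
move=> x; apply: (@cvg_sumr _ _ _ (nbhs x)) => i.
by apply: cvgMl_tmp; exact: coord_expR_cvg.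
Qed.

Lemma dexpsum_continuous c (z : E * E) :
  {for z, continuous (fun z : E * E => dexpsum c z.1 z.2)}.
Proof.
apply: (@cvg_sumr _ _ _ (nbhs z)) => i.
apply: cvgM.
  apply: cvgMl_tmp.
  apply: (@continuous_comp _ _ _ fst (fun x : E => expR (x ord0 i))).
    exact: cvg_fst.
  exact: coord_expR_cvg.
apply: (@continuous_comp _ _ _ snd (fun x : E => x ord0 i)).
  exact: cvg_snd.
exact: coord_continuous.
Qed.

(** The image of the softmax family under [K], on the same manifold. A positive entry in each column
    keeps the image weights positive; the score is the logarithmic derivative of the numerator minus
    that of the normalizer. *)
Lemma exists_softmax_model (m : nat) (k : R) (K : fin_sample n -> fin_sample m -> R) :
  1 <= k ->
  (forall i j, 0 <= K i j) -> (forall i, \sum_(j < m.+1) K i j = 1) ->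
  (forall j, exists i, 0 < K i j) ->
  exists S : stat_model (vspace_manifold 'rV[R]_n.+1) (unif R m) k,
    (forall x j, mweight S x j =
       expsum (K^~ j) x / expsum (fun=> 1) x) /\
    (forall (x : vspace_manifold 'rV[R]_n.+1) (V : tangent x) j,
       model_score S V j = dexpsum (K^~ j) x V / expsum (K^~ j) x -
         dexpsum (fun=> 1) x V / expsum (fun=> 1) x).
Proof.
move=> k1 K0 K1 Kc.
have Z0 x : 0 < expsum (fun=> 1) x.
  by apply: expsum_gt0 => //; exists ord0.
have ZK0 j x : 0 < expsum (K^~ j) x by exact: expsum_gt0.
pose q (x : E) (j : fin_sample m) := expsum (K^~ j) x / expsum (fun=> 1) x.
have q0 x w : 0 < q x w by rewrite divr_gt0.
have q1 x : \sum_(j < m.+1) q x j = 1.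
  rewrite -mulr_suml (_ : \sum_(j < m.+1) expsum (K^~ j) x = expsum (fun=> 1) x).
    by rewrite divff// gt_eqF.
  rewrite /expsum exchange_big/=; apply: eq_bigr => i _.
  by rewrite -mulr_suml K1.
have lnq j : (fun x => ln (m.+1%:R * q x j)) = (fun x => ln m.+1%:R +
    (ln (expsum (K^~ j) x) - ln (expsum (fun=> 1) x))).
  by apply/funext => x; rewrite lnM ?ln_div// posrE.
have Dq j x v : is_derive x v (fun x => ln (m.+1%:R * q x j))
    (dexpsum (K^~ j) x v / expsum (K^~ j) x -
     dexpsum (fun=> 1) x v / expsum (fun=> 1) x).
  rewrite lnq -[X in is_derive _ _ _ X]add0r.
  have D1 := is_derive_ln_expsum x v (fun i => K0 i j) (Kc j).
  have D2 := @is_derive_ln_expsum (fun=> 1) x v (fun=> ler01) (ex_intro _ ord0 ltr01).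
  apply: is_deriveD; exact: is_deriveB.
have gq j : @continuously_gateaux R (vspace_manifold E) (fun x => ln (m.+1%:R * q x j)).
  apply: (vspace_gateaux (Dq j)).
  - move=> x a u v /=; rewrite !dexpsum_linear; ring.
  - move=> z; apply: cvgB; apply: cvgM; try exact: dexpsum_continuous;
      apply: cvgV; rewrite ?gt_eqF//;
      apply: (@continuous_comp _ _ _ fst (expsum _)); try exact: cvg_fst;
      exact: expsum_continuous.
have [S Sq] := @exists_fin_model R (vspace_manifold E) m k q k1 q0 q1 gq.
exists S; split=> // x V j.
rewrite vspace_model_score.
rewrite (_ : (fun y => _) = (fun x => ln (m.+1%:R * q x j))).
  by case: (Dq j x V).
by apply/funext => y; rewrite potential_fin Sq.
Qed.

End softmax.

(** * Uniqueness *)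

Lemma linear_for_sum (R : realType) (T I : Type) (f : (T -> R) -> R) :
  GRing.linear_for *%R f -> forall (r : seq I) (c : I -> R) (g : I -> T -> R),
  f (fun w => \sum_(j <- r) c j * g j w) = \sum_(j <- r) c j * f (g j).
Proof.
move=> fl; have f0 : f 0 = 0.
  by have := fl 1 0 0; rewrite scaler0 addr0 mul1r => /eqP;
    rewrite -subr_eq0 opprD addrA subrr sub0r oppr_eq0 => /eqP.
elim=> [|j r IH] c g.
  rewrite big_nil -[RHS]f0; congr f; apply/funext => w; by rewrite big_nil.
rewrite big_cons -IH -fl; congr f; apply/funext => w.
by rewrite big_cons.
Qed.

Lemma rV_cvg (R : realType) (n : nat) (I : Type) (F : set_system I)
    (f : I -> 'rV[R]_n) (l : 'rV[R]_n) : Filter F ->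
  (forall i, f t ord0 i @[t --> F] --> l ord0 i) -> f t @[t --> F] --> l.
Proof.
move=> FF fl A [P /= nP PA].
have H : \forall t \near F, forall i, P ord0 i (f t ord0 i).
  by apply: filter_forall => i; exact: fl (nP ord0 i).
by apply: filterS H => t Pt; apply: PA => i j; rewrite (ord1 i).
Qed.

(** [b] reads off a list in which each [i] occurs [k i] times; the sum formula encodes the fibre
    sizes in the form used later. *)
Lemma exists_fibers (n L : nat) (k : 'I_n.+1 -> nat) :
  (\sum_(i < n.+1) k i = L.+1)%N ->
  exists b : 'I_L.+1 -> 'I_n.+1, forall (R : realType) (g : 'I_n.+1 -> R),
    \sum_(l < L.+1) g (b l) = \sum_(i < n.+1) (k i)%:R * g i.
Proof.
move=> kL; pose s := flatten [seq nseq (k i) i | i <- index_enum 'I_n.+1].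
have ss : size s = L.+1.
  rewrite size_flatten /shape -map_comp sumnE big_map -kL.
  by apply: eq_bigr => i _; rewrite /= size_nseq.
exists (fun l => nth ord0 s l) => R g.
rewrite -(big_mkord xpredT (fun l => g (nth ord0 s l))) -ss.
rewrite -(big_nth ord0 xpredT g) big_flatten big_map.
by apply: eq_bigr => i _; rewrite big_nseq iter_addr_0 mulr_natl.
Qed.

(** Double transitivity of the symmetric group, which leaves one free constant at a uniform
    distribution. The first transposition moves [x] to [i], the second keeps [i] and moves the image
    of [y] to [j]. *)
Lemma exists_perm2 (T : finType) (x y i j : T) : x != y -> i != j ->
  exists s : {perm T}, s x = i /\ s y = j.
Proof.
move=> xy ij; exists (tperm x i * tperm (tperm x i y) j)%g; rewrite !permM tpermL.
split; last by rewrite tpermL.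
rewrite tpermD// 1?eq_sym// -[X in X != _](tpermL x i).
by rewrite (inj_eq perm_inj).
Qed.

Lemma polarization (R : realType) (U : lmodType R) (B : U -> U -> R) :
  bilinear_for *%R *%R B -> (forall u v, B u v = B v u) ->
  forall u v, B u v = (B (u + v) (u + v) - B u u - B v v) / 2.
Proof.
move=> [Bl Br] Bs u v.
have lD w : {morph B w : x y / x + y}.
  by move=> x y; have := Br w 1 x y; rewrite scale1r /= mul1r.
by rewrite !(lD, Bs (u + v)) (Bs v u); field.
Qed.

Section chentsov.
Context {R : realType} {k : R}.
Hypothesis k1 : 1 <= k.
Variable F : form_field k.
Hypothesis Fwc : weakly_continuous_field F.
Hypothesis Fm : monotone_field F.
Variable Ft : forall n : nat, Pplus (unif R n) ->
  (fin_sample n -> R) -> (fin_sample n -> R) -> R.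
Hypothesis Ftb : forall n nu, bilinear_for *%R *%R (@Ft n nu).
Hypothesis FE : forall (M : banach_manifold R) (n : nat)
  (S : stat_model M (unif R n) k) (x : M) (V W : tangent x),
  F S V W = Ft (S x) (model_score S V) (model_score S W).

(* sqlen P a is the squared length of the tangent vector a of the simplex at P,
   whose score is a / P. *)
Definition sqlen n (P : Pplus (unif R n)) (a : 'I_n.+1 -> R) : R :=
  Ft P (fun i => a i / pweight P i) (fun i => a i / pweight P i).

Definition idker n (i j : fin_sample n) : R := ((i : 'I_n.+1) == j)%:R.

Lemma idker_sum n (i : 'I_n.+1) (f : 'I_n.+1 -> R) :
  \sum_(j < n.+1) f j * idker i j = f i.
Proof.
rewrite (bigD1 i)//= /idker eqxx mulr1 big1 ?addr0// => j ji.
by rewrite eq_sym (negbTE ji) mulr0.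
Qed.

Lemma idker_suml n (i : 'I_n.+1) (f : 'I_n.+1 -> R) :
  \sum_(j < n.+1) idker j i * f j = f i.
Proof.
by under eq_bigr do rewrite mulrC /idker eq_sym; exact: idker_sum.
Qed.

(** Softmax ignores adding a constant to all coordinates; this preimage of [P] is the one with
    normalizer 1. *)
Definition log_point n (P : Pplus (unif R n)) : 'rV[R]_n.+1 :=
  \row_i ln (pweight P (i : fin_sample n)).

Lemma expsum_log_point n (P : Pplus (unif R n)) c :
  expsum c (log_point P) = \sum_(i < n.+1) c i * pweight P (i : fin_sample n).
Proof.
by apply: eq_bigr => i _; rewrite mxE lnK// posrE; exact: pweight_gt0.
Qed.

Lemma expsum1_log_point n (P : Pplus (unif R n)) :
  expsum (fun=> 1) (log_point P) = 1.
Proof.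
rewrite expsum_log_point; under eq_bigr do rewrite mul1r; exact: pweight_sum.
Qed.

Lemma dexpsum_log_point n (P : Pplus (unif R n)) c (a : 'I_n.+1 -> R) :
  dexpsum c (log_point P) (\row_i (a i / pweight P (i : fin_sample n))) =
  \sum_(i < n.+1) c i * a i.
Proof.
apply: eq_bigr => i _; have p0 : 0 < pweight P (i : fin_sample n) by exact: pweight_gt0.
by rewrite !mxE lnK ?posrE// -mulrA [pweight P i * _]mulrC divfK// gt_eqF.
Qed.

Lemma idker_rowsum n (i : fin_sample n) : \sum_(j < n.+1) idker i j = 1.
Proof. by rewrite -[RHS](idker_sum i (fun=> 1)); apply: eq_bigr => j _; rewrite mul1r. Qed.

Lemma exists_simplex_model n : exists S : stat_model (vspace_manifold 'rV[R]_n.+1) (unif R n) k,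
  (forall x (j : 'I_n.+1), mweight S x j = expR (x ord0 j) / expsum (fun=> 1) x) /\
  (forall (x : vspace_manifold 'rV[R]_n.+1) (V : tangent x) (j : 'I_n.+1),
     model_score S V j = (V : 'rV[R]_n.+1) ord0 j - dexpsum (fun=> 1) x V / expsum (fun=> 1) x).
Proof.
have [|||S [Sw Ss]] := @exists_softmax_model R n n k (@idker n) k1.
- by move=> i j; rewrite ler0n.
- exact: idker_rowsum.
- by move=> j; exists j; rewrite /idker eqxx.
exists S; split=> [x j|x V j].
  by rewrite Sw /expsum idker_suml.
rewrite Ss /expsum /dexpsum idker_suml; congr (_ - _).
under eq_bigr do rewrite -mulrA.
rewrite (idker_suml j (fun i => expR (x ord0 i) * (V : 'rV[R]_n.+1) ord0 i)).
by rewrite mulrAC divff ?mul1r// gt_eqF// expR_gt0.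
Qed.

(** With the second model the image of the first under [K], the identity is a representable
    morphism. At [log_point P] the vector [a / P] has score [a / P], because the normalizer term is
    the sum of [a], and its image score is [a K / P']. *)
Lemma sqlen_monotone_pos n m (K : fin_sample n -> fin_sample m -> R)
    (P : Pplus (unif R n)) (P' : Pplus (unif R m)) (a : 'I_n.+1 -> R) :
  (forall i j, 0 < K i j) -> (forall i, \sum_(j < m.+1) K i j = 1) ->
  (forall j, pweight P' j = \sum_(i < n.+1) pweight P i * K i j) ->
  \sum_(i < n.+1) a i = 0 ->
  sqlen P' (fun j => \sum_(i < n.+1) a i * K i j) <= sqlen P a.
Proof.
move=> K0 K1 P'E a0.
have [S1 [S1w S1s]] := exists_simplex_model n.
have [|||S2 [S2w S2s]] := @exists_softmax_model R n m k K k1.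
- by move=> i j; exact: ltW.
- exact: K1.
- by move=> j; exists ord0.
have [|kappa kR] := exists_fin_representable (S1 := S1) (S2 := S2)
  (vspace_id_diffeomorphism _) K0 K1.
  move=> x j; rewrite S2w [expsum (K^~ j) x]/expsum mulr_suml; apply: eq_bigr => i _.
  by rewrite S1w -mulrA mulrC.
pose x : vspace_manifold 'rV[R]_n.+1 := log_point P.
pose V : tangent x := \row_i (a i / pweight P (i : fin_sample n)).
have := Fm kR V; rewrite (vspace_tangent_map_id V) !FE /sqlen.
have -> : S1 x = P.
  apply: Pplus_eq => w; rewrite -/(mweight S1 x w) S1w expsum1_log_point divr1.
  by rewrite mxE lnK// posrE; exact: pweight_gt0.
have -> : S2 (id x) = P'.
  apply: Pplus_eq => w; rewrite -/(mweight S2 x w) S2w expsum1_log_point divr1.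
  by rewrite expsum_log_point P'E; apply: eq_bigr => i _; rewrite mulrC.
have dx0 : dexpsum (fun=> 1) x V = 0.
  by rewrite dexpsum_log_point -[RHS]a0; apply: eq_bigr => i _; rewrite mul1r.
have -> : model_score S1 V = (fun i => a i / pweight P i).
  by apply/funext => i; rewrite S1s dx0 mul0r subr0 mxE.
have -> // : model_score S2 V =
    (fun j => (\sum_(i < n.+1) a i * K i j) / pweight P' j).
apply/funext => j; rewrite S2s dx0 mul0r subr0 dexpsum_log_point expsum_log_point.
rewrite P'E; congr (_ / _); apply: eq_bigr => i _; exact: mulrC.
Qed.

(** Weak continuity speaks of vector fields on one model, so the sequence is placed in the softmax
    manifold and [a] is spread to the field [X], whose score at [log_point P'] is [a / P']. *)
Lemma sqlen_cvg n (P_ : nat -> Pplus (unif R n)) (P : Pplus (unif R n)) (a : 'I_n.+1 -> R) :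
  \sum_(i < n.+1) a i = 0 ->
  (forall i, pweight (P_ t) i @[t --> \oo] --> pweight P i) ->
  sqlen (P_ t) a @[t --> \oo] --> sqlen P a.
Proof.
move=> a0 cP; have [S [Sw Ss]] := exists_simplex_model n.
pose X (x : 'rV[R]_n.+1) : 'rV[R]_n.+1 :=
  \row_i (a i * expsum (fun=> 1) x / expR (x ord0 i)).
have cX : continuous X.
  move=> x; apply: (@rV_cvg _ _ _ (nbhs x)) => i; rewrite mxE; under eq_fun do rewrite mxE.
  apply: cvgM; first by apply: cvgMl_tmp; exact: expsum_continuous.
  by apply: cvgV; [rewrite gt_eqF// expR_gt0|exact: coord_expR_cvg].
have cX' := vspace_continuous_vfield cX.
have QE (P' : Pplus (unif R n)) : sqlen P' a =
    @F _ _ S (log_point P' : vspace_manifold _) (X (log_point P')) (X (log_point P')).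
  rewrite FE.
  have -> : S (log_point P') = P'.
    apply: Pplus_eq => w; rewrite -/(mweight S (log_point P') w) Sw expsum1_log_point divr1.
    by rewrite mxE lnK// posrE; exact: pweight_gt0.
  rewrite /sqlen; suff -> : model_score S
      (X (log_point P') : tangent (log_point P' : vspace_manifold _)) =
    (fun i => a i / pweight P' i) by [].
  have XE : X (log_point P') = \row_i (a i / pweight P' (i : fin_sample n)).
    apply/rowP => i; rewrite !mxE expsum1_log_point mulr1 lnK// posrE.
    exact: pweight_gt0.
  apply/funext => i; rewrite Ss XE dexpsum_log_point mxE.
  under eq_bigr do rewrite mul1r.
  by rewrite a0 mul0r subr0.
rewrite QE; under eq_fun do rewrite QE.
have lc : log_point (P_ t) @[t --> \oo] --> log_point P.
  apply: rV_cvg => i; rewrite mxE; under eq_fun do rewrite mxE.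
  apply: (@cvg_comp _ _ _ (fun t => pweight (P_ t) i) (@ln R)) (cP i) _.
  by apply: continuous_ln; exact: pweight_gt0.
apply: (@cvg_comp _ _ _ (fun t => log_point (P_ t))
  (fun x => @F _ _ S (x : vspace_manifold _) (X x) (X x))) lc _.
exact: (@Fwc _ _ S X X cX' cX' (log_point P)).
Qed.

Definition sqlen_coef n (P : Pplus (unif R n)) (i j : 'I_n.+1) : R :=
  Ft P (fun w => idker i w / pweight P w) (fun w => idker j w / pweight P w).

Lemma Ft_sum n (P : Pplus (unif R n)) m (c : 'I_m -> R)
    (g : 'I_m -> fin_sample n -> R) :
  Ft P (fun w => \sum_(j < m) c j * g j w) (fun w => \sum_(j < m) c j * g j w) =
  \sum_(i < m) \sum_(j < m) c i * c j * Ft P (g i) (g j).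
Proof.
have [Fl Fr] := Ftb P.
rewrite (linear_for_sum (Fl _)); apply: eq_bigr => i _.
by rewrite (linear_for_sum (Fr _)) mulr_sumr; apply: eq_bigr => j _; rewrite mulrA.
Qed.

Lemma sqlen_expand n (P : Pplus (unif R n)) (a : 'I_n.+1 -> R) :
  sqlen P a = \sum_(i < n.+1) \sum_(j < n.+1) a i * a j * sqlen_coef P i j.
Proof.
rewrite -Ft_sum /sqlen; suff -> : (fun w : fin_sample n => a w / pweight P w) =
  (fun w => \sum_(j < n.+1) a j * (idker j w / pweight P w)) by [].
apply/funext => w; under eq_bigr do rewrite mulrA.
by rewrite -mulr_suml; under eq_bigr do rewrite mulrC; rewrite idker_suml.
Qed.

Lemma sqlen_scale n (P : Pplus (unif R n)) (c : R) (a : 'I_n.+1 -> R) :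
  sqlen P (fun i => c * a i) = c ^+ 2 * sqlen P a.
Proof.
rewrite !sqlen_expand mulr_sumr; apply: eq_bigr => i _; rewrite mulr_sumr.
by apply: eq_bigr => j _; ring.
Qed.

Lemma sqlen_diff n (P : Pplus (unif R n)) (i j : 'I_n.+1) :
  sqlen P (fun w => idker i w - idker j w) =
  sqlen_coef P i i - sqlen_coef P i j - sqlen_coef P j i + sqlen_coef P j j.
Proof.
have E (f : 'I_n.+1 -> R) (u v : 'I_n.+1) :
    \sum_(w < n.+1) (idker u w - idker v w) * f w = f u - f v.
  under eq_bigr do rewrite mulrBl ![idker _ _ * _]mulrC.
  by rewrite sumrB !idker_sum.
rewrite sqlen_expand; under eq_bigr do under eq_bigr do rewrite -mulrA.
by under eq_bigr do rewrite -mulr_sumr E; rewrite E; ring.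
Qed.

(** Terms depending on one index only cancel against a zero-sum vector. Differences of basis vectors
    are tangent to the simplex, unlike the basis vectors, and can thus be compared by
    monotonicity. *)
Lemma sqlen_zero_sum n (P : Pplus (unif R n)) (a : 'I_n.+1 -> R) :
  \sum_(i < n.+1) a i = 0 ->
  sqlen P a = - 2^-1 * \sum_(i < n.+1) \sum_(j < n.+1)
     a i * a j * sqlen P (fun w => idker i w - idker j w).
Proof.
move=> a0; rewrite sqlen_expand.
have z1 (f : 'I_n.+1 -> R) : \sum_(i < n.+1) \sum_(j < n.+1) a i * a j * f i = 0.
  rewrite big1// => i _; under eq_bigr do rewrite mulrAC.
  by rewrite -mulr_sumr a0 mulr0.
have z2 (f : 'I_n.+1 -> R) : \sum_(i < n.+1) \sum_(j < n.+1) a i * a j * f j = 0.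
  by rewrite exchange_big -[RHS](z1 f); apply: eq_bigr => i _;
    apply: eq_bigr => j _; rewrite [a j * _]mulrC.
have T : \sum_(i < n.+1) \sum_(j < n.+1) a i * a j * sqlen_coef P j i =
    \sum_(i < n.+1) \sum_(j < n.+1) a i * a j * sqlen_coef P i j.
  by rewrite exchange_big; apply: eq_bigr => i _; apply: eq_bigr => j _;
    rewrite [a j * _]mulrC.
have -> : \sum_(i < n.+1) \sum_(j < n.+1)
      a i * a j * sqlen P (fun w => idker i w - idker j w) =
    \sum_(i < n.+1) \sum_(j < n.+1) a i * a j * sqlen_coef P i i
    - \sum_(i < n.+1) \sum_(j < n.+1) a i * a j * sqlen_coef P i j
    - \sum_(i < n.+1) \sum_(j < n.+1) a i * a j * sqlen_coef P j i
    + \sum_(i < n.+1) \sum_(j < n.+1) a i * a j * sqlen_coef P j j.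
  rewrite -!sumrB -big_split/=; apply: eq_bigr => i _.
  rewrite -!sumrB -big_split/=; apply: eq_bigr => j _.
  by rewrite sqlen_diff; ring.
by rewrite T (z1 (fun i => sqlen_coef P i i)) (z2 (fun i => sqlen_coef P i i)); field.
Qed.

(** Mixing [K] with the uniform kernel makes it positive. The uniform part kills the zero-sum [a],
    so the image vector is merely scaled by [1 - e t], and [sqlen_cvg] handles the moving base
    point. *)
Lemma sqlen_monotone n m (K : 'I_n.+1 -> 'I_m.+1 -> R)
    (P : Pplus (unif R n)) (P' : Pplus (unif R m)) (a : 'I_n.+1 -> R) :
  (forall i j, 0 <= K i j) -> (forall i, \sum_(j < m.+1) K i j = 1) ->
  (forall j, pweight P' j = \sum_(i < n.+1) pweight P i * K i j) ->
  \sum_(i < n.+1) a i = 0 ->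
  sqlen P' (fun j => \sum_(i < n.+1) a i * K i j) <= sqlen P a.
Proof.
move=> K0 K1 P'E a0.
(* Shifted by 2 so that already [e 0 < 1]. *)
pose e t : R := t.+2%:R^-1.
have e0 t : 0 < e t by rewrite invr_gt0.
have e1 t : 0 < 1 - e t by rewrite subr_gt0 invf_lt1 ?ltr1n.
pose Ke t i j := (1 - e t) * K i j + e t / m.+1%:R.
have Ke0 t i j : 0 < Ke t i j by rewrite ltr_wpDl ?divr_gt0// mulr_ge0// ltW.
have Ke1 t i : \sum_(j < m.+1) Ke t i j = 1.
  rewrite big_split/= -mulr_sumr K1 sumr_const card_ord -mulrnAr -[_^-1 *+ _]mulr_natr.
  by rewrite mulVf ?pnatr_eq0// !mulr1 subrK.
pose q t j := (1 - e t) * pweight P' j + e t / m.+1%:R.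
have qE t j : q t j = \sum_(i < n.+1) pweight P i * Ke t i j.
  under eq_bigr do rewrite mulrDr mulrCA.
  by rewrite big_split/= -mulr_sumr -P'E -mulr_suml pweight_sum mul1r.
have q0 t j : 0 < q t j by rewrite ltr_wpDl ?divr_gt0// mulr_ge0// ltW// pweight_gt0.
have q1 t : \sum_(j < m.+1) q t j = 1.
  under eq_bigr do rewrite qE.
  rewrite exchange_big/=; under eq_bigr do rewrite -mulr_sumr Ke1 mulr1.
  exact: pweight_sum.
have [Pe PeE] := choice (fun t => exists_Pplus (q0 t) (q1 t)).
pose b j := \sum_(i < n.+1) a i * K i j.
have b0 : \sum_(j < m.+1) b j = 0.
  rewrite exchange_big/=; under eq_bigr do rewrite -mulr_sumr K1 mulr1.
  exact: a0.
have le t : (1 - e t) ^+ 2 * sqlen (Pe t) b <= sqlen P a.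
  rewrite -sqlen_scale.
  have -> : (fun j => (1 - e t) * b j) = (fun j => \sum_(i < n.+1) a i * Ke t i j).
    apply/funext => j; under [RHS]eq_bigr do rewrite mulrDr mulrCA.
    by rewrite big_split/= -mulr_sumr -mulr_suml a0 mul0r addr0.
  by apply: sqlen_monotone_pos => // j; rewrite PeE.
have ce : e t @[t --> \oo] --> (0 : R).
  have := @cvg_harmonic R; rewrite -(cvg_shiftS (@harmonic R)); exact.
have ce1 : 1 - e t @[t --> \oo] --> (1 : R).
  by rewrite -[X in _ --> X]subr0; apply: cvgB => //; exact: cvg_cst.
have cPe i : pweight (Pe t) i @[t --> \oo] --> pweight P' i.
  under eq_fun do rewrite PeE.
  suff : q t i @[t --> \oo] --> 1 * pweight P' i + 0 / m.+1%:R.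
    by rewrite mul1r mul0r addr0.
  by apply: cvgD; apply: cvgMr_tmp.
have cQ := sqlen_cvg b0 cPe.
have cL : (1 - e t) ^+ 2 * sqlen (Pe t) b @[t --> \oo] --> sqlen P' b.
  suff : (1 - e t) ^+ 2 * sqlen (Pe t) b @[t --> \oo] --> 1 * 1 * sqlen P' b by rewrite !mul1r.
  by apply: cvgM => //; apply: cvgM.
apply: (ler_cvg_to cL (cvg_cst (sqlen P a))); exact: nearW.
Qed.

Lemma sqlen_zero n (P : Pplus (unif R n)) (a : 'I_n.+1 -> R) : (forall i, a i = 0) -> sqlen P a = 0.
Proof.
move=> a0; rewrite sqlen_expand big1// => i _.
by rewrite big1// => j _; rewrite a0 !mul0r.
Qed.

(* The Markov embedding splitting the atom i into kappa i equal atoms has the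
   coarse-graining b as a left inverse. *)
Lemma sqlen_lump n L (b : 'I_L.+1 -> 'I_n.+1) (kappa : 'I_n.+1 -> R)
    (P : Pplus (unif R n)) (U : Pplus (unif R L)) (a : 'I_n.+1 -> R) :
  (forall i, 0 < kappa i) ->
  (forall g : 'I_n.+1 -> R, \sum_(l < L.+1) g (b l) = \sum_(i < n.+1) kappa i * g i) ->
  (forall i, pweight P i = kappa i / L.+1%:R) ->
  (forall l, pweight U l = L.+1%:R^-1) -> \sum_(i < n.+1) a i = 0 ->
  sqlen P a = sqlen U (fun l => a (b l) / kappa (b l)).
Proof.
move=> kap0 bE PE UE a0.
have kn0 i : kappa i != 0 by rewrite gt_eqF.
(* One inequality from the kernel spreading the mass of [i] evenly over its fibre, the other from
   the deterministic kernel of [b], which merges fibres and recovers [a]. *)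
apply: le_anti; apply/andP; split; last first.
  have -> : (fun l => a (b l) / kappa (b l)) =
      (fun l => \sum_(i < n.+1) a i * (idker (b l) i / kappa i)).
    apply/funext => l; under [RHS]eq_bigr do rewrite mulrCA mulrC.
    by rewrite idker_sum.
  apply: (@sqlen_monotone _ _ (fun i l => idker (b l) i / kappa i)) => // [i l|i|l].
  - by rewrite divr_ge0// ?ler0n// ltW.
  - rewrite (bE (fun w => idker w i / kappa i)).
    under eq_bigr do rewrite mulrCA.
    by rewrite (idker_suml i (fun j => kappa j / kappa i)) divff.
  - rewrite UE; under eq_bigr do rewrite mulrCA mulrC.
    by rewrite (idker_sum (b l) (fun i => pweight P i / kappa i)) PE mulrAC divff// mul1r.
pose c l := a (b l) / kappa (b l).
have aE : a = (fun i => \sum_(l < L.+1) c l * idker (b l) i).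
  apply/funext => i; rewrite (bE (fun w => a w / kappa w * idker w i)).
  under eq_bigr do rewrite [_ * idker _ _]mulrC mulrCA.
  by rewrite (idker_suml i (fun j => kappa j * (a j / kappa j))) mulrC divfK.
rewrite [X in sqlen P X]aE; apply: (@sqlen_monotone _ _ (fun l i => idker (b l) i)).
- by move=> l i; rewrite ler0n.
- by move=> l; exact: idker_rowsum.
- move=> i; under eq_bigr do rewrite UE.
  rewrite (bE (fun w => L.+1%:R^-1 * idker w i)).
  under eq_bigr do rewrite mulrA mulrC.
  by rewrite (idker_suml i (fun j => kappa j / L.+1%:R)) PE.
- rewrite (bE (fun w => a w / kappa w)) -[RHS]a0; apply: eq_bigr => i _.
  by rewrite mulrC divfK.
Qed.

(** A permutation is a splitting with one part per atom. *)
Lemma sqlen_perm L (U : Pplus (unif R L)) (s : {perm 'I_L.+1}) (a : 'I_L.+1 -> R) :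
  (forall l, pweight U l = L.+1%:R^-1) -> \sum_(i < L.+1) a i = 0 ->
  sqlen U (fun l => a (s l)) = sqlen U a.
Proof.
move=> UE a0; rewrite (@sqlen_lump _ _ s (fun=> 1) U U a)//.
- by congr (sqlen U _); apply/funext => l; rewrite divr1.
- move=> g; rewrite [RHS](reindex_inj (@perm_inj _ s)).
  by apply: eq_bigr => l _; rewrite mul1r.
- by move=> l; rewrite UE mul1r.
Qed.

Lemma idker_diff_sum n (i j : 'I_n.+1) : \sum_(w < n.+1) (idker i w - idker j w) = 0.
Proof. by rewrite sumrB !idker_rowsum subrr. Qed.

(** A permutation carries the reference pair ([ord0], [ord_max]) to ([i], [j]); the reference
    indices are distinct as soon as [i] and [j] are. For [i = j] both sides vanish. *)
Lemma sqlen_uniform_diff L (U : Pplus (unif R L)) (i j : 'I_L.+1) :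
  (forall l, pweight U l = L.+1%:R^-1) ->
  sqlen U (fun w => idker i w - idker j w) =
  sqlen U (fun w => idker ord0 w - idker ord_max w) * (1 - idker i j).
Proof.
move=> UE; have [->|ij] := eqVneq i j.
  by rewrite /idker eqxx subrr mulr0 sqlen_zero// => w; rewrite subrr.
rewrite [idker i j]/idker (negbTE ij) subr0 mulr1.
have [|s [s0 s1]] := @exists_perm2 _ (ord0 : 'I_L.+1) ord_max i j _ ij.
  rewrite -val_eqE /= eq_sym -lt0n.
  by case: L {U UE} i j ij => // i j; rewrite !ord1 eqxx.
rewrite -(sqlen_perm s UE (idker_diff_sum i j)); congr (sqlen U _); apply/funext => w.
by rewrite /idker -s0 -s1 !(inj_eq perm_inj).
Qed.

Lemma sqlen_uniform L (U : Pplus (unif R L)) (a : 'I_L.+1 -> R) :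
  (forall l, pweight U l = L.+1%:R^-1) -> \sum_(i < L.+1) a i = 0 ->
  sqlen U a = sqlen U (fun w => idker ord0 w - idker ord_max w) / 2 *
    \sum_(l < L.+1) a l ^+ 2.
Proof.
move=> UE a0; rewrite sqlen_zero_sum//.
set A := sqlen U (fun w => idker ord0 w - _).
have -> : \sum_(i < L.+1) \sum_(j < L.+1)
    a i * a j * sqlen U (fun w => idker i w - idker j w) = - (A * \sum_(l < L.+1) a l ^+ 2).
  rewrite mulr_sumr -sumrN; apply: eq_bigr => i _.
  under eq_bigr do rewrite sqlen_uniform_diff// mulrBr mulr1 mulrBr mulrAC (mulrA _ _ (idker _ _)).
  rewrite sumrB -mulr_sumr a0 mulr0 sub0r idker_sum; congr (- _); rewrite -/A.
  by ring.
by field.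
Qed.

Lemma exists_uniform L : exists U : Pplus (unif R L), forall l, pweight U l = L.+1%:R^-1.
Proof.
apply: exists_Pplus => [w|]; first by rewrite invr_gt0.
by rewrite sumr_const card_ord -[_ *+ _]mulr_natl mulfV ?pnatr_eq0.
Qed.

(** Points with common denominator [L.+1] all split into the same uniform distribution, so the
    constant depends on [L] alone. A fibre contributes $m_i(a_i/m_i)^2=a_i^2/m_i$, which is
    [a i ^+ 2 / pweight P i] divided by [L.+1]. *)
Lemma sqlen_rational L : exists C : R,
  forall n (m : 'I_n.+1 -> nat) (P : Pplus (unif R n)) (a : 'I_n.+1 -> R),
  (forall i, 0 < m i)%N -> (\sum_(i < n.+1) m i = L.+1)%N ->
  (forall i, pweight P i = (m i)%:R / L.+1%:R) -> \sum_(i < n.+1) a i = 0 ->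
  sqlen P a = C * \sum_(i < n.+1) a i ^+ 2 / pweight P i.
Proof.
have [U UE] := exists_uniform L.
exists (sqlen U (fun w => idker ord0 w - idker ord_max w) / 2 / L.+1%:R).
move=> n m P a m0 mL PE a0; have [b bE] := exists_fibers mL.
have m0' i : 0 < (m i)%:R :> R by rewrite ltr0n.
rewrite (sqlen_lump m0' (bE R) PE UE a0) sqlen_uniform//; last first.
  rewrite (bE R (fun i => a i / (m i)%:R)) -[RHS]a0; apply: eq_bigr => i _.
  by rewrite mulrC divfK// gt_eqF.
rewrite (bE R (fun i => (a i / (m i)%:R) ^+ 2)) -[in RHS]mulrA; congr (_ * _).
rewrite mulr_sumr; apply: eq_bigr => i _; rewrite PE.
have L0 : L.+1%:R != 0 :> R by rewrite pnatr_eq0.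
move: (m0' i) L0; move: (m i)%:R L.+1%:R (a i) => u v w u0 v0.
by field; rewrite v0 gt_eqF.
Qed.

(** A uniform distribution is also rational over every multiple of its denominator, so constants
    agree along multiples. [0 < L] excludes the one-point space, where every tangent vector is zero
    and no constant can be read off. *)
Lemma sqlen_rational_const : exists c : R,
  forall L n (m : 'I_n.+1 -> nat) (P : Pplus (unif R n)) (a : 'I_n.+1 -> R),
  (0 < L)%N ->
  (forall i, 0 < m i)%N -> (\sum_(i < n.+1) m i = L.+1)%N ->
  (forall i, pweight P i = (m i)%:R / L.+1%:R) -> \sum_(i < n.+1) a i = 0 ->
  sqlen P a = c * \sum_(i < n.+1) a i ^+ 2 / pweight P i.
Proof.
have [C CE] := choice sqlen_rational.
have CM L L' : (0 < L)%N -> C L = C (L.+1 * L'.+1).-1.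
  move=> L0; have [U UE] := exists_uniform L.
  (* A tangent vector of non-zero Fisher length, so that the constants can be cancelled. *)
  pose a w : R := idker ord0 w - idker (ord_max : 'I_L.+1) w.
  have a0 : \sum_(i < L.+1) a i = 0 by exact: idker_diff_sum.
  have s0 : \sum_(i < L.+1) a i ^+ 2 / pweight U i != 0.
    rewrite gt_eqF// (bigD1 ord0)//= ltr_wpDr//.
      by apply: sumr_ge0 => i _; rewrite divr_ge0 ?sqr_ge0// UE invr_ge0.
    rewrite divr_gt0 ?UE ?invr_gt0// /a /idker eqxx -val_eqE /= gtn_eqF//.
    by rewrite subr0 expr1n.
  apply: (mulIf s0).
  rewrite -(CE L L (fun=> 1%N) U a)// => [||l]; last by rewrite UE mul1r.
    apply: (CE _ L (fun=> L'.+1) U a) => // [|l]; first by rewrite sum_nat_const card_ord; lia.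
    rewrite UE prednK ?muln_gt0// natrM invfM mulrCA mulfV ?mulr1// pnatr_eq0.
  by rewrite sum_nat_const card_ord muln1.
(* Index 1 means denominator 2; both constants equal the one for denominator [2 * L.+1]. *)
exists (C 1%N) => L n m P a L0 m0 mL PE a0.
by rewrite (CM 1%N L)// mulnC -(CM L 1%N)//; exact: CE PE a0.
Qed.

Lemma sqlen_unique : exists c : R, forall n (P : Pplus (unif R n)) (a : 'I_n.+1 -> R),
  \sum_(i < n.+1) a i = 0 -> sqlen P a = c * \sum_(i < n.+1) a i ^+ 2 / pweight P i.
Proof.
(* The one-point space has only the zero tangent vector; with at least two atoms [L t] below is
   positive. *)
have [c cE] := sqlen_rational_const; exists c => -[|n] P a a0.
  rewrite big_ord_recl big_ord0 addr0 in a0.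
  rewrite big_ord_recl big_ord0 a0 expr0n /= mul0r addr0 mulr0.
  by apply: sqlen_zero => i; rewrite ord1.
(* The successor keeps numerators positive. They need not add up to [t.+1], so their sum [(L t).+1]
   is the denominator; its ratio to [t.+1] tends to 1. *)
pose m t (i : 'I_n.+2) := (Num.truncn (t.+1%:R * pweight P i)).+1.
pose L t := (\sum_(i < n.+2) m t i).-1.
have LE t : (\sum_(i < n.+2) m t i)%N = (L t).+1.
  by rewrite /L prednK// big_ord_recl.
have L0 t : (0 < L t)%N by rewrite /L !big_ord_recl /= !addSn addnS.
have p0 i : 0 < pweight P i by exact: pweight_gt0.
pose q t (i : fin_sample n.+1) : R := (m t i)%:R / (L t).+1%:R.
have q0 t i : 0 < q t i by rewrite divr_gt0.
have q1 t : \sum_(i < n.+2) q t i = 1.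
  by rewrite -mulr_suml -natr_sum LE divff.
have [P_ PE] := choice (fun t => exists_Pplus (q0 t) (q1 t)).
have cm i : (m t i)%:R / t.+1%:R @[t --> \oo] --> pweight P i.
  apply: (@squeeze_cvgr _ _ _ _ (fun=> pweight P i) (fun t => pweight P i + t.+1%:R^-1)).
  - apply: nearW => t; have /truncn_itv/andP[l u] : 0 <= t.+1%:R * pweight P i.
      by rewrite mulr_ge0// ltW.
    rewrite ler_pdivlMr// ler_pdivrMr// mulrDl mulVf// mulrC ltW//=.
    by rewrite /m -natr1 lerD2r.
  - exact: cvg_cst.
  - rewrite -[X in _ --> X]addr0; apply: cvgD; [exact: cvg_cst|exact: cvg_harmonic].
have cL : (L t).+1%:R / t.+1%:R @[t --> \oo] --> (1 : R).
  under eq_fun do rewrite -LE natr_sum mulr_suml.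
  suff : \sum_i (m t i)%:R / t.+1%:R @[t --> \oo] --> \sum_(i < n.+2) pweight P i.
    by rewrite pweight_sum.
  by apply: (@cvg_sumr _ _ _ \oo).
have cP i : pweight (P_ t) i @[t --> \oo] --> pweight P i.
  suff : (m t i)%:R / t.+1%:R / ((L t).+1%:R / t.+1%:R) @[t --> \oo] --> pweight P i / 1.
    rewrite divr1; apply: cvg_trans; apply: near_eq_cvg; apply: nearW => t.
    by rewrite PE /q invf_div mulrA divfK// pnatr_eq0.
  by apply: cvgM => //; apply: cvgV; rewrite ?oner_eq0.
rewrite -(cvg_lim _ (sqlen_cvg a0 cP))//; apply: cvg_lim => //.
under eq_fun do rewrite (cE _ _ _ _ _ (L0 _) _ (LE _) (PE _) a0)//.
apply: cvgMl_tmp; apply: (@cvg_sumr _ _ _ \oo) => i.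
by apply: cvgMl_tmp; apply: cvgV => //; rewrite gt_eqF.
Qed.

(** Every score is [a / P] for the zero-sum vector [a] of weights times scores, so [sqlen_unique]
    gives the diagonal. Symmetry of [F], which [Ft] need not share on all functions, then allows
    polarization. *)
Lemma form_field_fisher : symmetric_bilinear_field F -> exists c : R,
  forall (M : banach_manifold R) (n : nat) (S : stat_model M (unif R n) k)
    (x : M) (V W : tangent x), F S V W = c * fisher S V W.
Proof.
move=> Fsb; have [c cE] := sqlen_unique; exists c => M n S x V W.
have diag (U : tangent x) : F S U U = c * fisher S U U.
  pose a (i : 'I_n.+1) := mweight S x i * model_score S U i.
  have aE : (fun i => a i / pweight (S x) i) = model_score S U.
    by apply/funext => i; rewrite /a mulrAC divff ?mul1r// gt_eqF// mweight_gt0.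
  rewrite FE -[in LHS]aE -/(sqlen (S x) a) cE; last exact: model_score_mean.
  rewrite fisher_fin; congr (_ * _); apply: eq_bigr => i _.
  by rewrite expr2 -mulrA -[a i / _]/((fun i => a i / pweight (S x) i) i) aE mulrAC mulrA.
have [Fl Fs] := Fsb M n S x; have [Gl Gs] := fisher_field_symmetric_bilinear S x.
rewrite (polarization Fl Fs V W) -/(fisher_field S V W) (polarization Gl Gs V W).
by rewrite (diag (V + W)) (diag V) (diag W) mulrA -!mulrBr.
Qed.

End chentsov.

Theorem corollary4p11 (R : realType) :
  (forall (k : R), 2 <= k ->
   forall (M : banach_manifold R) (n1 n2 : nat)
     (Omega1 : smooth_manifold R n1) (Omega2 : smooth_manifold R n2)
     (mu1 : probability (borel Omega1) R) (mu2 : probability (borel Omega2) R),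
   lebesgue_measure_on mu1 -> lebesgue_measure_on mu2 ->
   forall (S1 : stat_model M mu1 k) (S2 : stat_model M mu2 k)
     (f : M -> M) (K : R.-pker (borel Omega1) ~> (borel Omega2)),
   representable_morphism S1 S2 f K ->
   forall (x : M) (V : tangent x),
     fisher S2 (tangent_map f V) (tangent_map f V) <= fisher S1 V V)
  /\
  (forall (k : R), 1 <= k ->
   [/\ symmetric_bilinear_field (@fisher_field R k),
       local_field (@fisher_field R k),
       weakly_continuous_field (@fisher_field R k),
       monotone_field (@fisher_field R k)
     & forall F : form_field k,
         symmetric_bilinear_field F -> local_field F ->
         weakly_continuous_field F -> monotone_field F ->
         exists c : R,
           forall (M : banach_manifold R) (n : nat)
             (S : stat_model M (unif R n) k) (x : M) (V W : tangent x),
             F M n S x V W = c * fisher S V W]).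
Proof.
split=> [k k2 M n1 n2 O1 O2 mu1 mu2 _ _ S1 S2 f K fK x V|k k1].
  by apply: fisher_monotone fK; exact: score_usc_ge2.
split; [exact: fisher_field_symmetric_bilinear|exact: fisher_field_local
  |exact: fisher_field_weakly_continuous|exact: fisher_field_monotone|].
move=> F Fsb [Ft [Ftb FE]] Fwc Fm.
exact: (form_field_fisher k1 Fwc Fm Ftb FE Fsb).
Qed.
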